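(* Let $\mu\in\mathcal{M}$ not be a point mass, let $\alpha\in\mathbb{R}$, $p>1$, $q>0$, and put $q'=1+pq-p$ and $p'=pq/q'$. If $p^*q\ne1$ (i.e. $q'\neq 0$), then the following statements are equivalent: (1) the point $\alpha$ is an atom of $\mathbb{B}_{p,q}(\mu)$; (2) $F_{\mu^{\boxplus p}}(\alpha)=\alpha/q^*$ and the Julia–Carathéodory derivative $F_{\mu^{\boxplus p}}'(\alpha)\in(1,\infty)$; (3) $F_\mu(\alpha/p')=\alpha/q^*$ and the Julia–Carathéodory derivative $F_\mu'(\alpha/p')\in(1,p^* )$; (4) $F_\mu(\alpha/p')=\alpha/q^*$ and $0<f_\mu(\alpha/p')<1/(p-1)$. Moreover, if $\mathbb{B}_{p,q}(\mu)(\{\alpha\})=1-r^{-1}$ for some $r>1$, then $$F'_{\mu^{\boxplus p}}(\alpha)=1+\frac{1}{q(r-1)}$$ and $$F_\mu'(\alpha/p')=1+f_\mu(\alpha/p')=\frac{pq(r-1)+p}{pq(r-1)+p-1}=1+\frac{1}{q'(rp'-1)}.$$ In addition, if $p^*q<1$ then $\mathbb{B}_{p,q}(\mu)$ has at most one atom. In particular, the equivalence of (1)–(4), the formulas for $F'_{\mu^{\boxplus p}}(\alpha)$ and $F_\mu'(\alpha/p')$ at an atom $\alpha$ of mass $1-r^{-1}$, and the assertion that there is at most one atom when $p^*q<1$, hold for $\mathbb{B}_t(\mu)$, $t\in(0,\infty)\setminus\{1\}$ (the case $p=t+1$, $q=1/(t+1)$).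
   Context: $\mathcal{M}$ is the set of Borel probability measures on $\mathbb{R}$ and $\mathbb{C}^+$ is the open upper half-plane. For $\mu\in\mathcal{M}$: $G_\mu(z)=\int_{\mathbb{R}}\frac{d\mu(s)}{z-s}$, $F_\mu=1/G_\mu$, $E_\mu(z)=z-F_\mu(z)$ for $z\in\mathbb{C}^+$; $F_\mu$ has a right inverse $F_\mu^{-1}$ on some truncated cone $\Gamma_{a,b}=\{x+iy:|x|\le a y,\ y\ge b\}$, and $\phi_\mu(z)=F_\mu^{-1}(z)-z$ there. For $p\ge1$, $\mu^{\boxplus p}\in\mathcal{M}$ is the unique measure with $\phi_{\mu^{\boxplus p}}=p\,\phi_\mu$ on some truncated cone (it always exists). For $q\ge0$, $\mu^{\uplus q}\in\mathcal{M}$ is the unique measure with $E_{\mu^{\uplus q}}=qE_\mu$. $\mathbb{B}_{p,q}(\mu)=(\mu^{\boxplus p})^{\uplus q}$, and $\mathbb{B}_t=\mathbb{B}_{t+1,1/(t+1)}$. For $r>0$, $r^*$ is the conjugate exponent, $\frac1r+\frac1{r^*}=1$ (negative if $r<1$), with $r^*=\infty$, $1/r^*=0$ if $r=1$; thus $\alpha/q^*=\alpha(1-1/q)$. $F_\mu$ has the Nevanlinna representation $F_\mu(z)=\Re F_\mu(i)+z+\int_{\mathbb{R}}\frac{1+sz}{s-z}\,d\rho(s)$ with a unique finite positive Borel measure $\rho$ on $\mathbb{R}$, and $f_\mu(x)=\int_{\mathbb{R}}\frac{s^2+1}{(s-x)^2}\,d\rho(s)\in[0,\infty]$ for $x\in\mathbb{R}$.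 For $x\in\mathbb{R}$, $F_\mu(x)=c$ means that $F_\mu(z)\to c$ as $z\to x$ nontangentially ($z\in\mathbb{C}^+$, $(\Re z-x)/\Im z$ bounded). The Julia–Carathéodory derivative $F_\mu'(x)$ is the nontangential limit of $\frac{F_\mu(z)-F_\mu(x)}{z-x}$ as $z\to x$. *)

(* Defs.v *)
From HB Require Import structures.
From mathcomp Require Import all_boot all_order all_algebra.
From mathcomp Require Import all_classical all_reals all_analysis.
From mathcomp Require Import complex.

Set Implicit Arguments.
Unset Strict Implicit.
Unset Printing Implicit Defensive.

Import Order.TTheory GRing.Theory Num.Theory.
Import numFieldNormedType.Exports.

Local Open Scope classical_set_scope.
Local Open Scope ring_scope.
Local Open Scope complex_scope.

Section Transforms.
Variable R : realType.
Local Notation C := R[i].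
Local Notation borelR := (measurableTypeR R).
Implicit Types (mu nu lam : probability borelR R) (z : C).

Definition upper_half_plane : set C := [set z | 0 < complex.Im z].

Definition truncated_cone (a b : R) : set C :=
  [set z | `|complex.Re z| <= a * complex.Im z /\ b <= complex.Im z].

Definition cintegral (m : {measure set borelR -> \bar R}) (f : R -> C) : C :=
  (\int[m]_(s in setT) complex.Re (f s))%R
    +i* (\int[m]_(s in setT) complex.Im (f s))%R.

Definition cauchy_transform mu z : C :=
  cintegral mu (fun s => (z - s%:C)^-1).

Definition F_transform mu z : C := (cauchy_transform mu z)^-1.

Definition E_transform mu z : C := z - F_transform mu z.

(* A right inverse of F is not unique in general, since F need not be
   injective on the upper half-plane.  The condition H z / z --> 1 at infinity
   selects the usual branch: F is injective far out in every truncated cone. *)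
Definition F_right_inverse mu (a b : R) (H : C -> C) : Prop :=
  (forall z, truncated_cone a b z ->
     upper_half_plane (H z) /\ F_transform mu (H z) = z) /\
  (forall e : R, 0 < e -> exists M : R, forall z,
     truncated_cone a b z -> M%:C <= `|z| -> `|H z / z - 1| < e%:C).

Definition voiculescu_transform mu (a b : R) (phi : C -> C) : Prop :=
  exists2 H, F_right_inverse mu a b H &
    forall z, truncated_cone a b z -> phi z = H z - z.

(* nu is the free convolution power of mu of exponent p *)
Definition free_power (p : R) mu nu : Prop :=
  exists a b : R, [/\ 0 < a, 0 < b &
    exists phi psi : C -> C,
      [/\ voiculescu_transform mu a b phi,
          voiculescu_transform nu a b psi &
          forall z, truncated_cone a b z -> psi z = p%:C * phi z]].

(* lam is the Boolean convolution power of nu of exponent q *)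
Definition boolean_power (q : R) nu lam : Prop :=
  forall z, upper_half_plane z -> E_transform lam z = q%:C * E_transform nu z.

(* lam = B_{p,q}(mu), where nu is the intermediate free power of mu *)
Definition is_Bpq (p q : R) mu nu lam : Prop :=
  free_power p mu nu /\ boolean_power q nu lam.

Definition is_Bt (t : R) mu nu lam : Prop :=
  is_Bpq (t + 1) (1 / (t + 1)) mu nu lam.

(* Stated on Borel sets only: measures are functions on all sets, whose values
   on non-measurable sets are irrelevant. *)
Definition is_point_mass mu : Prop :=
  exists a : R, forall A : set borelR, measurable A -> mu A = \d_(a : borelR) A.

Definition is_atom lam (x : R) : Prop := (0 < lam [set x])%E.

Definition nevanlinna_measure mu
    (rho : {finite_measure set borelR -> \bar R}) : Prop :=
  forall z, upper_half_plane z ->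
    F_transform mu z = (complex.Re (F_transform mu 'i))%:C + z
      + cintegral rho (fun s => (1 + s%:C * z) / (s%:C - z)).

(* The case split gives the integrand its value +oo at s = x, where division
   by zero in R would yield 0. *)
Definition f_function (rho : {finite_measure set borelR -> \bar R}) (x : R)
    : \bar R :=
  (\int[rho]_(s in setT)
     (if s == x then +oo else ((s ^+ 2 + 1) / (s - x) ^+ 2)%:E))%E.

Definition nontangential_limit (f : C -> C) (x : R) (l : C) : Prop :=
  forall a : R, 0 < a ->
    f @ within [set z | upper_half_plane z /\
                        `|complex.Re z - x| <= a * complex.Im z]
               (nbhs (x%:C : C^o)) --> (l : C^o).

Definition JC_derivative (f : C -> C) (x : R) (d : C) : Prop :=
  exists2 c, nontangential_limit f x c &
    nontangential_limit (fun z => (f z - c) / (z - x%:C)) x d.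

(* For r = 1 this is 0^-1 = 0 in place of oo; since x / 0 = 0 in R, the
   quotient x / conjugate_exponent 1 still has the intended value 0. *)
Definition conjugate_exponent (r : R) : R := (1 - r^-1)^-1.

Definition q_prime (p q : R) : R := 1 + p * q - p.
Definition p_prime (p q : R) : R := p * q / q_prime p q.

(* In the next two definitions nu and lam stand for the free power of mu of
   exponent p and for B_{p,q}(mu), and rho for the Nevanlinna measure of mu. *)

Definition atom_equivalences (p q : R) mu rho nu lam (alpha : R) : Prop :=
  let x := alpha / p_prime p q in
  let c := (alpha / conjugate_exponent q)%:C in
  [<-> is_atom lam alpha;
       nontangential_limit (F_transform nu) alpha c /\
         (exists2 d : R, 1 < d & JC_derivative (F_transform nu) alpha d%:C);
       nontangential_limit (F_transform mu) x c /\
         (exists2 d : R, 1 < d < conjugate_exponent p &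
            JC_derivative (F_transform mu) x d%:C);
       nontangential_limit (F_transform mu) x c /\
         (0 < f_function rho x < (1 / (p - 1))%:E)%E].

Definition atom_formulas (p q : R) mu rho nu lam (alpha : R) : Prop :=
  let x := alpha / p_prime p q in
  forall r : R, 1 < r -> lam [set alpha] = (1 - r^-1)%:E ->
    JC_derivative (F_transform nu) alpha (1 + 1 / (q * (r - 1)))%:C /\
    exists d : R,
      [/\ JC_derivative (F_transform mu) x d%:C,
          d%:E = (1 + f_function rho x)%E,
          d = (p * q * (r - 1) + p) / (p * q * (r - 1) + p - 1) &
          d = 1 + 1 / (q_prime p q * (r * p_prime p q - 1))].

Definition at_most_one_atom lam : Prop :=
  forall x y : R, is_atom lam x -> is_atom lam y -> x = y.

End Transforms.

(* Main.v *)
Require Import Defs.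
From mathcomp Require Import all_boot all_order all_algebra.
From mathcomp Require Import all_classical all_reals all_analysis.
From mathcomp Require Import measurable_realfun complex.
From mathcomp Require Import cyclic separable cyclotomic ring lra.

(** Write p for the exponent of the free power [nu] of [mu], and [lam] for the
    Boolean power of [nu] of exponent q. Everything is read off from the boundary
    behaviour of the three reciprocal Cauchy transforms.

    From [nu] to [lam] the passage is affine: [F_lam z = (1 - q) z + q F_nu z]
    ([F_boolean_power]). A point a carries mass m of [lam] exactly when
    [(z - a) / F_lam z] tends to m nontangentially ([cauchy_atom]), so atoms of
    [lam] are the points where [F_nu] has a prescribed real value and a finite
    Julia-Caratheodory derivative, and m and this derivative determine each other.

    From [mu] to [nu] the passage is the subordination function
    [omega z = z / p + (1 - 1 / p) F_nu z]. The relation between the Voiculescu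
    transforms says that [F_mu (omega z) = F_nu z] far out in a cone, and
    the identity theorem extends it to the upper half-plane ([F_subordination]).
    The identity theorem is proved for uniform limits of polynomials on discs
    ([approximable_identity]), a class that contains Cauchy transforms and is
    stable under composition. Conversely omega is inverted by
    [psi z = p z - (p - 1) F_mu z] wherever psi takes values in the upper
    half-plane ([subordinationK]): the Nevanlinna representation and the
    inequality between arithmetic and geometric means show that psi is injective
    there.

    At the boundary, finiteness of f at x is equivalent to the existence of a real
    boundary value of [F_mu] with a finite derivative, which is then [1 + f x].
    Dominated convergence gives one direction ([julia_caratheodory]); Fatou's lemma
    gives the other, and a single nontangential sequence is enough
    ([f_function_of_sequence]). If [F_nu] has derivative d at a, then omega has the
    positive derivative [1 / p + (1 - 1 / p) d] there and transports vertical
    approach to a into nontangential approach to the base point, where [F_mu] has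
    the quotient of the two as derivative ([free_power_to_base]). If
    [f x < 1 / (p - 1)], then psi has the positive derivative [1 - (p - 1) f x] at x
    and transports vertical approach back ([base_to_free_power]); one sequence at a
    suffices to compute the mass of [lam] there. The equivalence is thus a cycle:
    atom of [lam], boundary data of [F_nu], boundary data of [F_mu], bound on f,
    atom of [lam]. The strict inequalities hold because a mass equal to 1
    would force [f = 0] at the base point, hence [rho = 0] and [mu] a point mass.

    When q is less than [1 - 1 / p], two atoms would give two boundary points
    between which the real function [F_mu - id] has slope larger than
    [1 / (p - 1)], whereas the Nevanlinna representation bounds this slope by the mean of the two values of f,
    both smaller than [1 / (p - 1)] ([two_boundary_points]). *)

Set Implicit Arguments.
Unset Strict Implicit.
Unset Printing Implicit Defensive.

Import Order.TTheory GRing.Theory Num.Theory.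
Import numFieldNormedType.Exports.
Import poly.UnityRootTheory.

Local Open Scope classical_set_scope.
Local Open Scope ring_scope.
Local Open Scope complex_scope.
Local Notation normc := ComplexField.Normc.normc.

(** * The real-valued modulus of a complex number *)

Section ComplexNorm.
Variable R : realType.
Local Notation C := R[i].
Implicit Types (x y z : C).

Lemma normc_ge0 z : 0 <= normc z.
Proof. by case: z => a b; exact: sqrtr_ge0. Qed.

Lemma normr_normc z : `|z| = (normc z)%:C.
Proof. by []. Qed.

Lemma normc_eq0 z : (normc z == 0) = (z == 0).
Proof.
apply/eqP/eqP => [/ComplexField.Normc.eq0_normc//|->].
exact: ComplexField.Normc.normc0.
Qed.

Lemma normc_gt0 z : (0 < normc z) = (z != 0).
Proof. by rewrite lt_neqAle normc_ge0 andbT eq_sym normc_eq0. Qed.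

Lemma normcM x y : normc (x * y) = normc x * normc y.
Proof. exact: ComplexField.Normc.normcM. Qed.

Lemma normcV z : normc z^-1 = (normc z)^-1.
Proof. exact: ComplexField.Normc.normcV. Qed.

Lemma normcX z n : normc (z ^+ n) = normc z ^+ n.
Proof.
elim: n => [|n IHn]; last by rewrite !exprS normcM IHn.
by rewrite !expr0 ComplexField.Normc.normc1.
Qed.

Lemma normcD x y : normc (x + y) <= normc x + normc y.
Proof. exact: le_normcD. Qed.

Lemma normcN z : normc (- z) = normc z.
Proof. exact: complex.normcN. Qed.

Lemma normcB x y : normc (x - y) <= normc x + normc y.
Proof. by rewrite -(normcN y); exact: normcD. Qed.

Lemma normc_distC x y : normc (x - y) = normc (y - x).
Proof. by rewrite -normcN opprB. Qed.

Lemma normc_sum (n : nat) (F : 'I_n -> C) :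
  normc (\sum_(i < n) F i) <= \sum_(i < n) normc (F i).
Proof.
elim/big_rec2: _ => [|i y x _ le_xy]; first by rewrite ComplexField.Normc.normc0.
by apply: le_trans (normcD _ _) _; rewrite lerD2l.
Qed.

Lemma normc_sqr z : normc z ^+ 2 = complex.Re z ^+ 2 + complex.Im z ^+ 2.
Proof. by case: z => a b /=; rewrite sqr_sqrtr// addr_ge0 ?sqr_ge0. Qed.

Lemma normr_Re_le z : `|complex.Re z| <= normc z.
Proof.
rewrite -(ler_pXn2r (n := 2)) ?nnegrE ?normc_ge0//.
by rewrite normc_sqr real_normK ?num_real// lerDl sqr_ge0.
Qed.

Lemma normr_Im_le z : `|complex.Im z| <= normc z.
Proof.
rewrite -(ler_pXn2r (n := 2)) ?nnegrE ?normc_ge0//.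
by rewrite normc_sqr real_normK ?num_real// lerDr sqr_ge0.
Qed.

Lemma Re_le_normc z : complex.Re z <= normc z.
Proof. exact: le_trans (ler_norm _) (normr_Re_le z). Qed.

Lemma Im_le_normc z : complex.Im z <= normc z.
Proof. exact: le_trans (ler_norm _) (normr_Im_le z). Qed.

Lemma normc_le_ReIm z : normc z <= `|complex.Re z| + `|complex.Im z|.
Proof.
rewrite -(ler_pXn2r (n := 2)) ?nnegrE ?normc_ge0 ?addr_ge0//.
rewrite normc_sqr sqrrD !real_normK ?num_real//.
by rewrite -addrA lerD2l lerDr mulrn_wge0// mulr_ge0.
Qed.

Lemma normc_real (x : R) : normc x%:C = `|x|.
Proof. by rewrite /= expr0n addr0 sqrtr_sqr. Qed.

Lemma Re_add x y : complex.Re (x + y) = complex.Re x + complex.Re y.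
Proof. by case: x y => [? ?] [? ?]. Qed.
Lemma Im_add x y : complex.Im (x + y) = complex.Im x + complex.Im y.
Proof. by case: x y => [? ?] [? ?]. Qed.
Lemma Re_opp x : complex.Re (- x) = - complex.Re x.
Proof. by case: x. Qed.
Lemma Im_opp x : complex.Im (- x) = - complex.Im x.
Proof. by case: x. Qed.
Lemma Re_mul x y : complex.Re (x * y) =
  complex.Re x * complex.Re y - complex.Im x * complex.Im y.
Proof. by case: x y => [? ?] [? ?]. Qed.
Lemma Im_mul x y : complex.Im (x * y) =
  complex.Re x * complex.Im y + complex.Im x * complex.Re y.
Proof. by case: x y => [? ?] [? ?]. Qed.
Lemma Re_inv x : complex.Re (x^-1) = complex.Re x / normc x ^+ 2.
Proof. by rewrite normc_sqr; case: x => [? ?]. Qed.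
Lemma Im_inv x : complex.Im (x^-1) = - (complex.Im x / normc x ^+ 2).
Proof. by rewrite normc_sqr; case: x => [? ?]. Qed.

Lemma Im_realM (r : R) x : complex.Im (r%:C * x) = r * complex.Im x.
Proof. by rewrite Im_mul /= mul0r addr0. Qed.

Definition ReImE := (Re_add, Im_add, Re_opp, Im_opp, Re_mul, Im_mul).

Lemma complex_eqP x y : complex.Re x = complex.Re y ->
  complex.Im x = complex.Im y -> x = y.
Proof. by case: x y => [? ?] [? ?] /= -> ->. Qed.

Lemma upper_neq0 z : 0 < complex.Im z -> z != 0.
Proof. by apply: contraTneq => ->; rewrite ltxx. Qed.

End ComplexNorm.

(** * Limits of complex sequences *)

Section ComplexLimits.
Variable R : realType.
Local Notation C := R[i].
Implicit Types (u v : nat -> C) (a b l : C).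

(** Convergence in the topology of [R[i]^o]. It is sealed in an inductive
    type, so that only the lemmas below are used about it. *)
Variant ctends u l : Prop := Ctends of u @ \oo --> (l : C^o).

Lemma ctendsP u l : ctends u l <->
  (fun n => normc (u n - l)) @ \oo --> (0 : R).
Proof.
split=> [[ul]|ul].
  apply/cvgrPdist_lt => e e0.
  have eC : 0 < e%:C :> C by rewrite ltcR.
  have /(@cvgrPdist_lt C C^o) /(_ _ eC) := ul.
  apply: filterS => n; rewrite distrC normr_normc ltcR => h.
  by rewrite sub0r normrN ger0_norm ?normc_ge0.
split; apply/(@cvgrPdist_lt C C^o) => e e0.
have [Re0 ->] : 0 < complex.Re e /\ e = (complex.Re e)%:C.
  move: e0; rewrite ltcE => /andP[/eqP h1 h2]; split=> //.
  by case: e h1 h2 => ? ? /= ->.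
have /cvgrPdist_lt /(_ _ Re0) := ul.
apply: filterS => n; rewrite sub0r normrN ger0_norm ?normc_ge0// => h.
by rewrite distrC normr_normc ltcR.
Qed.

Lemma ctends_squeeze u l (e : nat -> R) :
  (\forall n \near \oo, normc (u n - l) <= e n) -> e @ \oo --> (0 : R) ->
  ctends u l.
Proof.
move=> ue e0; apply/ctendsP.
apply: (@squeeze_cvgr _ _ _ _ (cst 0) e) => //; last exact: cvg_cst.
by apply: filterS ue => n ->; rewrite normc_ge0.
Qed.

Lemma ctends_near u v l : (\forall n \near \oo, u n = v n) ->
  ctends u l -> ctends v l.
Proof. by move=> uv [ul]; split; apply: cvg_trans ul; exact: near_eq_cvg. Qed.

Lemma eq_ctends u v l : (forall n, u n = v n) -> ctends u l -> ctends v l.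
Proof. by move=> uv; apply: ctends_near; near=> n; exact: uv. Unshelve. all: by end_near. Qed.

Lemma ctends_cst a : ctends (fun=> a) a.
Proof. split; exact: (@cvg_cst C^o a nat \oo). Qed.

Lemma ctendsD u v a b : ctends u a -> ctends v b ->
  ctends (fun n => u n + v n) (a + b).
Proof. by case=> ua [vb]; split; exact: (@cvgD C C^o nat \oo _ u v a b ua vb). Qed.

Lemma ctendsN u a : ctends u a -> ctends (fun n => - u n) (- a).
Proof. by case=> ua; split; exact: (@cvgN C C^o nat \oo _ u a ua). Qed.

Lemma ctendsB u v a b : ctends u a -> ctends v b ->
  ctends (fun n => u n - v n) (a - b).
Proof. by move=> ua vb; apply: ctendsD => //; exact: ctendsN. Qed.

Lemma ctendsM u v a b : ctends u a -> ctends v b ->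
  ctends (fun n => u n * v n) (a * b).
Proof. by case=> ua [vb]; split; exact: (@cvgM C nat \oo _ u v a b ua vb). Qed.

Lemma ctendsZ c u a : ctends u a -> ctends (fun n => c * u n) (c * a).
Proof. by apply: ctendsM; exact: ctends_cst. Qed.

Lemma ctendsV u a : a != 0 -> ctends u a ->
  ctends (fun n => (u n)^-1) (a^-1).
Proof. by move=> a0 [ua]; split; exact: (@cvgV C nat \oo _ u a a0 ua). Qed.

Lemma ctends_Re u a : ctends u a ->
  (fun n => complex.Re (u n)) @ \oo --> complex.Re a.
Proof.
move=> /ctendsP ua; apply/cvgrPdist_le => e e0.
have /cvgrPdist_lt /(_ _ e0) := ua.
apply: filterS => n; rewrite sub0r normrN ger0_norm ?normc_ge0// => h.
by rewrite distrC; apply: le_trans (ltW h); rewrite -Re_opp -Re_add normr_Re_le.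
Qed.

Lemma ctends_Im u a : ctends u a ->
  (fun n => complex.Im (u n)) @ \oo --> complex.Im a.
Proof.
move=> /ctendsP ua; apply/cvgrPdist_le => e e0.
have /cvgrPdist_lt /(_ _ e0) := ua.
apply: filterS => n; rewrite sub0r normrN ger0_norm ?normc_ge0// => h.
by rewrite distrC; apply: le_trans (ltW h); rewrite -Im_opp -Im_add normr_Im_le.
Qed.

Lemma ctends_unique u a b : ctends u a -> ctends u b -> a = b.
Proof.
move=> ua ub; apply: complex_eqP.
  exact: (cvg_unique (@norm_hausdorff _ R) (ctends_Re ua) (ctends_Re ub)).
exact: (cvg_unique (@norm_hausdorff _ R) (ctends_Im ua) (ctends_Im ub)).
Qed.

Lemma ctends_ReIm u a :
  (fun n => complex.Re (u n)) @ \oo --> complex.Re a ->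
  (fun n => complex.Im (u n)) @ \oo --> complex.Im a -> ctends u a.
Proof.
move=> uRe uIm.
apply: (@ctends_squeeze _ _ (fun n => `|complex.Re (u n) - complex.Re a| +
   `|complex.Im (u n) - complex.Im a|)).
  by near=> n; rewrite (le_trans (normc_le_ReIm _))// !ReImE.
rewrite -[0 in X in _ --> X](addr0 (0 : R)).
apply: cvgD.
  rewrite -[0 in X in _ --> X](@normr0 R R) -(subrr (complex.Re a)).
  by apply: cvg_norm; apply: cvgB => //; exact: cvg_cst.
rewrite -[0 in X in _ --> X](@normr0 R R) -(subrr (complex.Im a)).
by apply: cvg_norm; apply: cvgB => //; exact: cvg_cst.
Unshelve. all: by end_near. Qed.

Lemma ctends_shift u l N : ctends u l -> ctends (fun n => u (n + N)%N) l.
Proof.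
move=> /ctendsP ul; apply/ctendsP.
by rewrite (cvg_shiftn N (fun n => normc (u n - l))).
Qed.

End ComplexLimits.

(** * Integrals of complex-valued functions *)

Section ComplexIntegral.
Variable R : realType.
Local Notation C := R[i].
Local Notation borelR := (measurableTypeR R).
Implicit Types (f g : borelR -> C).

Definition cmeasurable f : Prop :=
  measurable_fun [set: borelR] (fun s => complex.Re (f s)) /\
  measurable_fun [set: borelR] (fun s => complex.Im (f s)).

Lemma cmeasurable_cst (c : C) : cmeasurable (fun=> c).
Proof. by split; exact: measurable_cst. Qed.

Lemma cmeasurable_real (h : borelR -> R) : measurable_fun [set: borelR] h ->
  cmeasurable (fun s => (h s)%:C).
Proof. by move=> mh; split => //=; exact: measurable_cst. Qed.

Lemma cmeasurable_id : cmeasurable (fun s => s%:C).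
Proof. exact: (@cmeasurable_real id). Qed.

Lemma eq_cmeasurable f g : (forall s, f s = g s) -> cmeasurable f -> cmeasurable g.
Proof. by move=> /funext ->. Qed.

Lemma cmeasurableD f g : cmeasurable f -> cmeasurable g ->
  cmeasurable (fun s => f s + g s).
Proof.
move=> [f1 f2] [g1 g2]; split.
  by under eq_fun do rewrite Re_add; exact: measurable_funD.
by under eq_fun do rewrite Im_add; exact: measurable_funD.
Qed.

Lemma cmeasurableN f : cmeasurable f -> cmeasurable (fun s => - f s).
Proof.
move=> [f1 f2]; split.
  by under eq_fun do rewrite Re_opp; exact: measurable_funN.
by under eq_fun do rewrite Im_opp; exact: measurable_funN.
Qed.

Lemma cmeasurableB f g : cmeasurable f -> cmeasurable g ->
  cmeasurable (fun s => f s - g s).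
Proof. by move=> mf mg; apply: cmeasurableD => //; exact: cmeasurableN. Qed.

Lemma cmeasurableM f g : cmeasurable f -> cmeasurable g ->
  cmeasurable (fun s => f s * g s).
Proof.
move=> [f1 f2] [g1 g2]; split.
  under eq_fun do rewrite Re_mul.
  by apply: measurable_funB; exact: measurable_funM.
under eq_fun do rewrite Im_mul.
by apply: measurable_funD; exact: measurable_funM.
Qed.

Lemma measurable_inv_ge0 (h : borelR -> R) : (forall s, 0 <= h s) ->
  measurable_fun [set: borelR] h -> measurable_fun [set: borelR] (fun s => (h s)^-1).
Proof.
move=> h0 mh; under eq_fun do rewrite -powR_inv1//.
exact: (measurableT_comp (measurable_powR (R := R) (-1)) mh).
Qed.

Lemma cmeasurable_normc2 f : cmeasurable f ->
  measurable_fun [set: borelR] (fun s => normc (f s) ^+ 2).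
Proof.
move=> [f1 f2]; under eq_fun do rewrite normc_sqr.
by apply: measurable_funD; exact: measurable_funX.
Qed.

Lemma cmeasurableV f : cmeasurable f -> cmeasurable (fun s => (f s)^-1).
Proof.
move=> mf; have [f1 f2] := mf.
have mV : measurable_fun [set: borelR] (fun s => (normc (f s) ^+ 2)^-1).
  by apply: measurable_inv_ge0 => [s|]; [exact: sqr_ge0|exact: cmeasurable_normc2].
split.
  by under eq_fun do rewrite Re_inv; exact: measurable_funM.
under eq_fun do rewrite Im_inv.
by apply: measurable_funN; exact: measurable_funM.
Qed.

Section Measure.
Variable m : {measure set borelR -> \bar R}.

Definition cintegrable f : Prop :=
  m.-integrable [set: borelR] (fun s => (complex.Re (f s))%:E) /\
  m.-integrable [set: borelR] (fun s => (complex.Im (f s))%:E).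

Lemma eq_cintegral f g : (forall s, f s = g s) -> cintegral m f = cintegral m g.
Proof. by move=> /funext ->. Qed.

Lemma cintegralD f g : cintegrable f -> cintegrable g ->
  cintegral m (fun s => f s + g s) = cintegral m f + cintegral m g.
Proof.
move=> [f1 f2] [g1 g2]; apply: complex_eqP; rewrite !ReImE /=.
  by rewrite -RintegralD//; apply: eq_Rintegral => s _; rewrite Re_add.
by rewrite -RintegralD//; apply: eq_Rintegral => s _; rewrite Im_add.
Qed.

Lemma cintegrableD f g : cintegrable f -> cintegrable g ->
  cintegrable (fun s => f s + g s).
Proof.
move=> [f1 f2] [g1 g2]; split.
  by under eq_fun do rewrite Re_add EFinD; exact: integrableD.
by under eq_fun do rewrite Im_add EFinD; exact: integrableD.
Qed.

Lemma integrableZl_EFin (k : R) (h : borelR -> R) :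
  m.-integrable setT (EFin \o h) -> m.-integrable setT (fun s => (k * h s)%:E).
Proof. by move=> mh; under eq_fun do rewrite EFinM; exact: integrableZl. Qed.

Lemma cintegrableZ (c : C) f : cintegrable f -> cintegrable (fun s => c * f s).
Proof.
move=> [f1 f2]; split.
  under eq_fun do rewrite Re_mul EFinB.
  by apply: integrableB => //; exact: integrableZl_EFin.
under eq_fun do rewrite Im_mul EFinD.
by apply: integrableD => //; exact: integrableZl_EFin.
Qed.

Lemma cintegralZ (c : C) f : cintegrable f ->
  cintegral m (fun s => c * f s) = c * cintegral m f.
Proof.
move=> [f1 f2].
have ReZ k : \int[m]_(s in setT) (k * complex.Re (f s)) =
   k * \int[m]_(s in setT) (complex.Re (f s)) by exact: RintegralZl.
have ImZ k : \int[m]_(s in setT) (k * complex.Im (f s)) =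
   k * \int[m]_(s in setT) (complex.Im (f s)) by exact: RintegralZl.
apply: complex_eqP; rewrite !ReImE /= -ReZ -ImZ.
  rewrite -RintegralB//; [|exact: integrableZl_EFin..].
  by apply: eq_Rintegral => s _; rewrite Re_mul.
rewrite -RintegralD//; [|exact: integrableZl_EFin..].
by apply: eq_Rintegral => s _; rewrite Im_mul.
Qed.

Lemma cintegralB f g : cintegrable f -> cintegrable g ->
  cintegral m (fun s => f s - g s) = cintegral m f - cintegral m g.
Proof.
move=> f1 g1; rewrite -[in RHS](mulN1r (cintegral m g)) -cintegralZ//.
rewrite -cintegralD//; last exact: cintegrableZ.
by apply: eq_cintegral => s; rewrite mulN1r.
Qed.

(** The real and the imaginary parts are bounded separately, whence the
    factor 2. *)
Lemma normc_cintegral_le f (g : borelR -> R) : cintegrable f ->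
  m.-integrable [set: borelR] (EFin \o g) -> (forall s, normc (f s) <= g s) ->
  normc (cintegral m f) <= 2 * \int[m]_(s in setT) g s.
Proof.
move=> [f1 f2] ig fg; rewrite (le_trans (normc_le_ReIm _))//= mulr_natl mulr2n.
by apply: lerD; rewrite (le_trans (le_normr_Rintegral _ _))//;
  apply: le_Rintegral => //=; do ?[exact: integrable_norm];
  move=> s _; apply: le_trans (fg s); rewrite ?normr_Re_le ?normr_Im_le.
Qed.

(** Dominated convergence. The dominating function is extended real, so that
    the integrand of [f_function], infinite at one point, can serve. *)
Lemma cintegral_dominated (f_ : nat -> borelR -> C) f (g : borelR -> \bar R) N :
  (forall n, cmeasurable (f_ n)) -> cmeasurable f ->
  m.-integrable [set: borelR] g ->
  {ae m, forall s, ctends (f_ ^~ s) (f s)} ->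
  {ae m, forall s, forall n, (N <= n)%N -> ((normc (f_ n s))%:E <= g s)%E} ->
  cintegrable f /\ ctends (fun n => cintegral m (f_ n)) (cintegral m f).
Proof.
move=> mf_ mf ig f_f f_g.
have part (h : C -> R) : (forall n, measurable_fun [set: borelR] (h \o f_ n)) ->
    measurable_fun [set: borelR] (h \o f) -> (forall z, `|h z| <= normc z) ->
    (forall u l, ctends u l -> (fun n => h (u n)) @ \oo --> h l) ->
    m.-integrable [set: borelR] (EFin \o (h \o f)) /\
    (fun n => \int[m]_(s in setT) h (f_ n s)) @ \oo --> \int[m]_(s in setT) h (f s).
  move=> mhf_ mhf hle hlim.
  have [] := @dominated_convergence _ _ _ m setT measurableT
    (fun n s => (h (f_ (n + N)%N s))%:E) (EFin \o (h \o f)) g.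
  - by move=> n; apply/measurable_EFinP; exact: mhf_.
  - by apply/measurable_EFinP.
  - apply: filterS f_f => s fs _; apply/fine_cvgP; split; first by near=> n.
    by have := hlim _ _ (ctends_shift N fs).
  - by [].
  - apply: filterS f_g => s fg n _; rewrite abse_EFin.
    by apply: le_trans (fg _ (leq_addl n N)); rewrite lee_fin.
  move=> ihf _ cv; split=> //.
  rewrite -(cvg_shiftn N) /=; apply: fine_cvg.
  by rewrite /Rintegral fineK//; exact: integrable_fin_num.
have [i1 c1] := part _ (fun n => (mf_ n).1) mf.1 (@normr_Re_le R) (@ctends_Re R).
have [i2 c2] := part _ (fun n => (mf_ n).2) mf.2 (@normr_Im_le R) (@ctends_Im R).
by split; [split|exact: ctends_ReIm].
Unshelve. all: by end_near. Qed.

End Measure.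

Lemma cintegrable_bounded (m : {finite_measure set borelR -> \bar R}) f (M : R) :
  cmeasurable f -> (forall s, normc (f s) <= M) -> cintegrable m f.
Proof.
move=> [f1 f2] fM; split; apply: measurable_bounded_integrable => //.
- by rewrite -ge0_fin_numE// fin_num_measure.
- exists M; split; first exact: num_real.
  by move=> x Mx s _ /=; rewrite (le_trans (normr_Re_le _))// (le_trans (fM s))// ltW.
- by rewrite -ge0_fin_numE// fin_num_measure.
exists M; split; first exact: num_real.
by move=> x Mx s _ /=; rewrite (le_trans (normr_Im_le _))// (le_trans (fM s))// ltW.
Qed.

Lemma integrable_bounded (m : {finite_measure set borelR -> \bar R})
    (h : borelR -> R) (M : R) : measurable_fun [set: borelR] h ->
  (forall s, `|h s| <= M) -> m.-integrable [set: borelR] (EFin \o h).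
Proof.
move=> mh hM; apply: measurable_bounded_integrable => //.
  by rewrite -ge0_fin_numE// fin_num_measure.
exists M; split; first exact: num_real.
by move=> x Mx s _ /=; rewrite (le_trans (hM s))// ltW.
Qed.

End ComplexIntegral.

(** * Uniform polynomial approximation and the identity theorem *)

Section PolynomialApproximation.
Variable R : realType.
Local Notation C := R[i].
Implicit Types (P : {poly C}) (D : set C) (f g : C -> C).

Lemma complex_prim_root_exists n : (0 < n)%N ->
  exists z : C, n.-primitive_root z.
Proof.
pose p : {poly C} := 'X^n - 1; have [r Dp] := closed_field_poly_normal p.
move=> n_gt0; rewrite (monicP _) ?monicXnsubC // scale1r in Dp.
have rn1 : all n.-unity_root r by apply/allP=> z; rewrite -root_prod_XsubC -Dp.
have sz_r : (n < (size r).+1)%N.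
  by rewrite -(size_prod_XsubC r id) -Dp size_XnsubC.
have [|z] := hasP (has_prim_root n_gt0 rn1 _ sz_r); last by exists z.
by rewrite -separable_prod_XsubC -Dp separable_Xn_sub_1 // pnatr_eq0 -lt0n.
Qed.

Lemma normc_unity_root n (z : C) : (0 < n)%N -> z ^+ n = 1 -> normc z = 1.
Proof.
move=> n0 zn; apply/eqP; rewrite -(pexpr_eq1 n0) ?normc_ge0//.
by rewrite -normcX zn ComplexField.Normc.normc1.
Qed.

Lemma normc_natr n : normc (n%:R : C) = n%:R.
Proof. by rewrite -(rmorph_nat (real_complex R)) normc_real normr_nat. Qed.

(** Cauchy's estimate. The
    average over the N-th roots of unity, with N the size of the polynomial,
    plays the part of the integral over the circle. *)
Lemma normc_coef_le P (r M : R) n : 0 <= r ->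
  (forall z, normc z <= r -> normc P.[z] <= M) -> normc P`_n * r ^+ n <= M.
Proof.
move=> r0 PM; have [le_n|lt_n] := leqP (size P) n.
  rewrite nth_default// ComplexField.Normc.normc0 mul0r.
  by apply: le_trans (PM 0 _); rewrite ?normc_ge0// ComplexField.Normc.normc0.
set N := size P in lt_n *; have N0 : (0 < N)%N by exact: leq_ltn_trans lt_n.
have [w w_prim] := complex_prim_root_exists N0.
have wN : w ^+ N = 1 := prim_expr_order w_prim.
have nw : normc w = 1 := normc_unity_root N0 wN.
(* averaging over the N-th roots of unity isolates the coefficient of X^n *)
have avg : \sum_(j < N) w ^+ (j * (N - n)) * P.[r%:C * w ^+ j] =
    N%:R * (P`_n * r%:C ^+ n).
  under eq_bigr => j _ do rewrite horner_coef big_distrr /=.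
  rewrite exchange_big (bigD1 (Ordinal lt_n)) //= [X in _ + X]big1 ?addr0.
    rewrite (eq_bigr (fun=> P`_n * r%:C ^+ n)).
      by rewrite sumr_const card_ord mulr_natl.
    move=> j _; rewrite exprMn mulrCA [w ^+ _ * _]mulrCA -exprM -exprD -mulnDr.
    by rewrite subnK 1?ltnW// mulnC exprM wN expr1n mulr1.
  move=> k kn; rewrite (eq_bigr (fun j : 'I_N =>
      P`_k * r%:C ^+ k * (w ^+ (N - n + k)) ^+ j)); last first.
    move=> j _; rewrite exprMn mulrCA [w ^+ _ * _]mulrCA -!exprM -exprD -mulnDr.
    by rewrite mulrA [(j * _)%N]mulnC.
  rewrite -mulr_sumr; set x := w ^+ (N - n + k).
  have x1 : x != 1.
    rewrite /x -(prim_order_dvd w_prim); apply: contra kn => dv.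
    rewrite -val_eqE /=; rewrite addnBAC 1?ltnW// in dv.
    have : (k = n %[mod N])%N.
      apply/eqP; rewrite -(modnDl k N); have -> : (N + k = N + k - n + n)%N.
        by rewrite subnK// (leq_trans (ltnW lt_n))// leq_addr.
      by rewrite eqn_mod_dvd ?leq_addl// addnK.
    by rewrite !modn_small// => ->.
  have : (x - 1) * \sum_(j < N) x ^+ j = 0.
    by rewrite -subrX1 /x -exprM mulnC exprM wN expr1n subrr.
  by move/eqP; rewrite mulf_eq0 subr_eq0 (negbTE x1) /= => /eqP ->; rewrite mulr0.
have : normc (N%:R * (P`_n * r%:C ^+ n)) <= N%:R * M.
  rewrite -avg (le_trans (normc_sum _))//.
  rewrite -[X in _ <= X%:R * _]card_ord mulr_natl -sumr_const ler_sum// => j _.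
  rewrite normcM normcX nw expr1n mul1r PM// normcM normc_real normcX nw.
  by rewrite expr1n mulr1 ger0_norm.
rewrite normcM normc_natr ler_pM2l ?ltr0n// normcM normcX normc_real.
by rewrite ger0_norm.
Qed.

Lemma horner_bounded P (B : R) :
  exists2 M, 0 <= M & forall z, normc z <= B -> normc P.[z] <= M.
Proof.
elim/poly_ind: P => [|P c [M M0 PM]].
  by exists 0 => // z _; rewrite horner0 ComplexField.Normc.normc0.
exists (M * `|B| + normc c) => [|z zB]; first by rewrite addr_ge0 ?mulr_ge0 ?normc_ge0.
rewrite hornerMXaddC (le_trans (normcD _ _))// lerD2r normcM.
by rewrite ler_pM ?normc_ge0 ?PM// (le_trans zB)// ler_norm.
Qed.

Lemma horner_lipschitz P (B : R) : exists2 L, 0 <= L &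
  forall a b, normc a <= B -> normc b <= B -> normc (P.[a] - P.[b]) <= L * normc (a - b).
Proof.
elim/poly_ind: P => [|P c [L L0 PL]].
  by exists 0 => // a b _ _; rewrite !horner0 subrr ComplexField.Normc.normc0 mul0r.
have [M M0 PM] := horner_bounded P B.
exists (`|B| * L + M) => [|a b aB bB]; first by rewrite addr_ge0 ?mulr_ge0.
rewrite !hornerMXaddC.
have -> : P.[a] * a + c - (P.[b] * b + c) = a * (P.[a] - P.[b]) + (a - b) * P.[b].
  by ring.
rewrite (le_trans (normcD _ _))// [leRHS]mulrDl !normcM lerD//.
  by rewrite -mulrA ler_pM ?normc_ge0 ?PL// (le_trans aB)// ler_norm.
by rewrite mulrC ler_wpM2r ?normc_ge0 ?PM.
Qed.

(** On a closed disc, this class consists of the functions that are continuous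
    on the disc and holomorphic inside. It is stable under composition for elementary
    reasons, which is why it replaces complex differentiability here. *)
Definition approximable D f : Prop := forall e : R, 0 < e ->
  exists P, forall z, D z -> normc (f z - P.[z]) <= e.

Lemma approximable_id D : approximable D id.
Proof.
by move=> e e0; exists 'X => z _; rewrite hornerX subrr ComplexField.Normc.normc0 ltW.
Qed.

Lemma approximableD D f g : approximable D f -> approximable D g ->
  approximable D (fun z => f z + g z).
Proof.
move=> af ag e e0; have e2 : 0 < e / 2 by rewrite divr_gt0.
have [P Pf] := af _ e2; have [Q Qg] := ag _ e2; exists (P + Q) => z Dz.
rewrite hornerD opprD addrACA (le_trans (normcD _ _))//.
by rewrite [leRHS]splitr lerD ?Pf ?Qg.
Qed.

Lemma approximableZ D c f : approximable D f -> approximable D (fun z => c * f z).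
Proof.
move=> af e e0; have d0 : 0 < normc c + 1 by rewrite ltr_wpDl ?normc_ge0.
have [P Pf] := af _ (divr_gt0 e0 d0); exists (c *: P) => z Dz.
rewrite hornerZ -mulrBr normcM; apply: (@le_trans _ _ (normc c * (e / (normc c + 1)))).
  by rewrite ler_wpM2l ?normc_ge0 ?Pf.
by rewrite mulrCA ger_pMr// ler_pdivrMr// mul1r lerDl.
Qed.

(** Polynomials are Lipschitz on bounded sets, so replacing the inner function
    by an approximant costs little. The approximant may leave [D'] by at most 1,
    hence the Lipschitz constant is taken for the bound [B + 1]. *)
Lemma approximable_comp D D' (B : R) f g : (forall z, D' z -> normc z <= B) ->
  (forall z, D z -> D' (g z)) -> approximable D' f -> approximable D g ->
  approximable D (fun z => f (g z)).
Proof.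
move=> D'B gD af ag e e0; have e2 : 0 < e / 2 by rewrite divr_gt0.
have [P Pf] := af _ e2; have [L L0 PL] := horner_lipschitz P (B + 1).
have d0 : 0 < Num.min 1 (e / 2 / (L + 1)) by rewrite lt_min ltr01 !divr_gt0// ltr_wpDl.
have [Q Qg] := ag _ d0; exists (P \Po Q) => z Dz; rewrite horner_comp.
have -> : f (g z) - P.[Q.[z]] = f (g z) - P.[g z] + (P.[g z] - P.[Q.[z]]).
  by rewrite addrA subrK.
have := Qg _ Dz; rewrite le_min => /andP[Q1 Q2].
rewrite (le_trans (normcD _ _))// [leRHS]splitr lerD ?Pf//; first exact: gD.
have gB := D'B _ (gD _ Dz).
apply: le_trans (PL _ _ _ _) _; first by rewrite (le_trans gB)// lerDl.
  have -> : Q.[z] = g z - (g z - Q.[z]) by rewrite opprB addrC subrK.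
  by rewrite (le_trans (normcB _ _))// lerD.
apply: (@le_trans _ _ (L * (e / 2 / (L + 1)))); first by rewrite ler_wpM2l.
by rewrite mulrCA ger_pMr// ler_pdivrMr ?ltr_wpDl// mul1r lerDl.
Qed.

Definition cdisc (c : C) (r : R) : set C := [set z | normc (z - c) <= r].

Lemma cdisc_bounded c r z : cdisc c r z -> normc z <= r + normc c.
Proof. by move=> zc; rewrite -[z](subrK c) (le_trans (normcD _ _))// lerD2r. Qed.

Lemma geometric_sum_le (x : R) n : 0 <= x < 1 -> \sum_(i < n) x ^+ i <= (1 - x)^-1.
Proof.
move=> /andP[x0 x1]; have x10 : 0 < 1 - x by rewrite subr_gt0.
rewrite -[leLHS](mulKf (lt0r_neq0 x10)) ger_pMr ?invr_gt0//.
rewrite -opprB mulNr -subrX1 opprB lerBlDr lerDl.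
exact: exprn_ge0.
Qed.

(** The coefficient of index i is at most [e / r0 ^ i] and at most
    [M / r ^ i] by Cauchy's estimate. The first bound is used below index N, the
    second one from N on. *)
Lemma horner_normc_le P (r0 r e M t : R) (u : C) N :
  0 < r0 -> t < r -> 0 <= t -> 0 <= e -> normc u = t ->
  (forall z, normc z <= r0 -> normc P.[z] <= e) ->
  (forall z, normc z <= r -> normc P.[z] <= M) ->
  normc P.[u] <= e * (\sum_(i < N) (t / r0) ^+ i) + M * ((t / r) ^+ N * (1 - t / r)^-1).
Proof.
move=> r00 tr t0 e0 ut Pe PM.
have r_0 : 0 < r by exact: le_lt_trans tr.
have M0 : 0 <= M.
  by apply: le_trans (PM 0 _); rewrite ?normc_ge0 ?ComplexField.Normc.normc0 ?ltW.
have x0 : 0 <= t / r by rewrite divr_ge0// ltW.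
have x1 : t / r < 1 by rewrite ltr_pdivrMr// mul1r.
have term i : normc (P`_i * u ^+ i) <=
    (if (i < N)%N then e * (t / r0) ^+ i else 0) +
    (if (N <= i)%N then M * (t / r) ^+ i else 0).
  rewrite normcM normcX ut; case: leqP => iN; rewrite ?add0r ?addr0.
    rewrite expr_div_n mulrA ler_pdivlMr ?exprn_gt0// mulrAC.
    by rewrite ler_wpM2r ?exprn_ge0// (normc_coef_le _ (ltW r_0)).
  rewrite expr_div_n mulrA ler_pdivlMr ?exprn_gt0// mulrAC.
  by rewrite ler_wpM2r ?exprn_ge0// (normc_coef_le _ (ltW r00)).
rewrite horner_coef (le_trans (normc_sum _))//.
apply: (@le_trans _ _ (\sum_(i < size P) ((if (i < N)%N then e * (t / r0) ^+ i else 0) +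
    (if (N <= i)%N then M * (t / r) ^+ i else 0)))).
  by apply: ler_sum => i _; exact: term.
rewrite big_split /= lerD//.
  rewrite -big_mkcond /= mulr_sumr.
  rewrite -(big_mkord (fun i => (i < N)%N) (fun i => e * (t / r0) ^+ i)).
  rewrite -(big_mkord xpredT (fun i => e * (t / r0) ^+ i)).
  have [szN|Nsz] := leqP (size P) N.
    rewrite (big_cat_nat _ szN)//= [X in _ <= X + _]big_nat_cond.
    rewrite [X in X <= _]big_nat_cond (eq_bigl (fun i => (0 <= i < size P)%N && true)).
      by rewrite lerDl sumr_ge0// => i _; rewrite mulr_ge0 ?exprn_ge0 ?divr_ge0// ltW.
    by move=> i; rewrite andbT; case: ltnP => //= iP; exact: leq_trans szN.
  rewrite (big_cat_nat _ (ltnW Nsz))//= [X in _ + X]big1_seq ?addr0.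
    by rewrite big_mkcond big_nat [leRHS]big_nat ler_sum// => i /andP[_ ->].
  by move=> i /andP[iN]; rewrite mem_index_iota leqNgt iN.
rewrite -big_mkcond /=.
rewrite -(big_mkord (fun i => (N <= i)%N) (fun i => M * (t / r) ^+ i)).
have [szN|Nsz] := leqP (size P) N.
  rewrite big1_seq; first by rewrite !mulr_ge0 ?exprn_ge0 ?invr_ge0// subr_ge0 ltW.
  by move=> i /andP[Ni]; rewrite mem_index_iota ltnNge (leq_trans szN Ni) andbF.
rewrite (big_cat_nat _ (ltnW Nsz))//= [X in X + _]big1_seq ?add0r; last first.
  by move=> i /andP[Ni]; rewrite mem_index_iota ltnNge Ni andbF.
rewrite -[N in X in X <= _]add0n big_addn big_mkcond /=.
rewrite (eq_bigr (fun i => M * (t / r) ^+ N * (t / r) ^+ i)).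
  rewrite -mulr_sumr mulrA ler_wpM2l ?mulr_ge0 ?exprn_ge0// big_mkord.
  by apply: geometric_sum_le; rewrite x0.
by move=> i _; rewrite leq_addl addnC exprD mulrA.
Qed.

(** The identity theorem on a disc. An approximant with error e is at most e
    on the small disc and bounded by a fixed M on the large one. In
    [horner_normc_le] one first chooses N to make the tail small, then e to make
    the finitely many remaining terms small. *)
Lemma approximable_identity f c (r r0 : R) z : 0 < r0 -> r0 <= r ->
  approximable (cdisc c r) f -> (forall w, cdisc c r0 w -> f w = 0) ->
  normc (z - c) < r -> f z = 0.
Proof.
move=> r00 r0r af f0 zr; apply: contrapT => /eqP fz.
have d0 : 0 < normc (f z) by rewrite normc_gt0.
set d := normc (f z) in d0.
have [P1 P1f] := af 1 ltr01.
have [M1 M10 P1M] := horner_bounded P1 (r + normc c).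
have fM w : cdisc c r w -> normc (f w) <= 1 + M1.
  move=> wD; rewrite -[f w](subrK P1.[w]) (le_trans (normcD _ _))// lerD ?P1f//.
  exact/P1M/cdisc_bounded.
set t := normc (z - c) in zr; have t0 : 0 <= t by exact: normc_ge0.
have r_0 : 0 < r by exact: lt_le_trans r0r.
set x := t / r; have x0 : 0 <= x by rewrite divr_ge0// ltW.
have x1 : x < 1 by rewrite ltr_pdivrMr// mul1r.
pose M := 1 + M1 + 1; have M0 : 0 < M by rewrite ltr_wpDl// addr_ge0.
have [N xN] : exists N, M * (x ^+ N * (1 - x)^-1) < d / 4.
  have k0 : 0 < d / 4 * ((1 - x) / M) by rewrite mulr_gt0 ?divr_gt0 ?subr_gt0.
  have : (x ^+ n) @[n --> \oo] --> 0 by apply: cvg_expr; rewrite ger0_norm.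
  move=> /cvgrPdist_lt /(_ _ k0) [N _ NP]; exists N.
  have := NP N (leqnn N); rewrite sub0r normrN ger0_norm ?exprn_ge0//.
  move=> h; rewrite mulrA ltr_pdivrMr ?subr_gt0// mulrC -ltr_pdivlMr//.
  by rewrite -mulrA.
set S := \sum_(i < N) (t / r0) ^+ i.
have S0 : 0 <= S by rewrite sumr_ge0// => i _; rewrite exprn_ge0// divr_ge0// ltW.
pose e := Num.min 1 (d / 4 / (1 + S)).
have e0 : 0 < e by rewrite lt_min ltr01 !divr_gt0// ltr_pwDl.
have e1 : e <= 1 by rewrite ge_min lexx.
have eS : e * (1 + S) <= d / 4.
  by rewrite -ler_pdivlMr ?ltr_pwDl// ge_min lexx orbT.
have [P Pf] := af _ e0.
have Q1 u : normc u <= r0 -> normc (P \Po ('X + c%:P)).[u] <= e.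
  move=> ur; rewrite horner_comp !hornerE.
  have ucD : cdisc c r0 (u + c) by rewrite /cdisc /= addrK.
  have ucD' : cdisc c r (u + c) by exact: le_trans r0r.
  by have := Pf _ ucD'; rewrite f0// sub0r normcN.
have Q2 u : normc u <= r -> normc (P \Po ('X + c%:P)).[u] <= M.
  move=> ur; rewrite horner_comp !hornerE.
  have ucD : cdisc c r (u + c) by rewrite /cdisc /= addrK.
  have -> : P.[u + c] = f (u + c) - (f (u + c) - P.[u + c]) by ring.
  by rewrite (le_trans (normcB _ _))// lerD ?fM// (le_trans (Pf _ _)).
have := horner_normc_le N r00 zr t0 (ltW e0) erefl Q1 Q2.
rewrite horner_comp hornerD hornerX hornerC subrK -/S -/x => Pz.
have fd : d <= e + normc P.[z].
  rewrite /d -[f z](subrK P.[z]) (le_trans (normcD _ _))// lerD2r Pf//.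
  by rewrite /cdisc /= ltW.
have : d <= e + (e * S + d / 4).
  by rewrite (le_trans fd)// lerD2l (le_trans Pz)// lerD2l ltW.
rewrite addrA -[X in X + _]/(e + e * S) -{1}(mulr1 e) -mulrDr.
by move: eS d0; set q := e * _; clearbody q d; clear; lra.
Qed.

Lemma resolvent_geometric (c z s : C) N : z - s != 0 -> c - s != 0 ->
  (z - s)^-1 - \sum_(i < N) (- (z - c)) ^+ i * (c - s)^-1 ^+ i.+1 =
  (- (z - c) / (c - s)) ^+ N / (z - s).
Proof.
move=> zs cs; elim: N => [|N IHN]; first by rewrite big_ord0 subr0 expr0 mul1r.
rewrite big_ord_recr /= opprD addrA IHN !exprMn !exprS.
set A := (- (z - c)) ^+ N; set B := (c - s)^-1 ^+ N.
by field; rewrite zs cs.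
Qed.

Lemma normc_resolvent_le (c z s : C) (r k : R) N : r < k -> k <= normc (c - s) ->
  cdisc c r z ->
  normc ((z - s)^-1 - \sum_(i < N) (- (z - c)) ^+ i * (c - s)^-1 ^+ i.+1) <=
  (r / k) ^+ N / (k - r).
Proof.
move=> rk kc zr; have r0 : 0 <= r := le_trans (normc_ge0 _) zr.
have k0 : 0 < k := le_lt_trans r0 rk.
have cs : c - s != 0 by rewrite -normc_gt0 (lt_le_trans k0).
have nzs : k - r <= normc (z - s).
  rewrite lerBlDr (le_trans kc)//.
  have -> : c - s = (z - s) - (z - c) by ring.
  by rewrite (le_trans (normcB _ _))// lerD2l.
have zs : z - s != 0 by rewrite -normc_gt0 (lt_le_trans _ nzs)// subr_gt0.
rewrite resolvent_geometric// normcM normcX normcM normcN !normcV.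
apply: ler_pM; rewrite ?exprn_ge0 ?divr_ge0 ?invr_ge0 ?normc_ge0//.
  rewrite lerXn2r ?nnegrE ?divr_ge0 ?normc_ge0 ?(ltW k0)//.
  by rewrite ler_pM ?invr_ge0 ?normc_ge0// lef_pV2 ?posrE// normc_gt0.
by rewrite lef_pV2 ?posrE ?normc_gt0// subr_gt0.
Qed.

Lemma expr_small (x e : R) : 0 <= x < 1 -> 0 < e -> exists N, x ^+ N <= e.
Proof.
move=> /andP[x0 x1] e0.
have : (x ^+ n) @[n --> \oo] --> 0 by apply: cvg_expr; rewrite ger0_norm.
move=> /cvgrPdist_le /(_ _ e0) [N _ NP]; exists N.
by have := NP N (leqnn N); rewrite sub0r normrN ger0_norm ?exprn_ge0.
Qed.

Lemma approximable_inv (c : C) (r : R) : 0 <= r -> r < normc c ->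
  approximable (cdisc c r) (fun z => z^-1).
Proof.
move=> r0 rc e e0; have k0 : 0 < normc c := le_lt_trans r0 rc.
have [||N xN] := @expr_small (r / normc c) (e * (normc c - r)).
- by rewrite divr_ge0 ?normc_ge0//= ltr_pdivrMr// mul1r.
- by rewrite mulr_gt0// subr_gt0.
exists (\sum_(i < N) (- ('X - c%:P)) ^+ i * (c^-1 ^+ i.+1)%:P) => z zc.
have := normc_resolvent_le (s := 0) N rc _ zc; rewrite !subr0 => /(_ (lexx _)) h.
rewrite horner_sum; under eq_bigr do rewrite !hornerE.
by rewrite (le_trans h)// ler_pdivrMr// subr_gt0.
Qed.

End PolynomialApproximation.

(** * The Cauchy transform *)

Section CauchyTransform.
Variable R : realType.
Local Notation C := R[i].
Local Notation borelR := (measurableTypeR R).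
Implicit Types (mu nu : probability borelR R) (z w : C).

Lemma cmeasurable_resolvent z : cmeasurable (fun s : borelR => (z - s%:C)^-1).
Proof.
apply: cmeasurableV; apply: cmeasurableB; first exact: cmeasurable_cst.
exact: cmeasurable_id.
Qed.

Lemma Im_le_normc_subr z (s : R) : complex.Im z <= normc (z - s%:C).
Proof. by apply: le_trans (Im_le_normc _); rewrite !ReImE /= subr0. Qed.

Lemma subr_real_neq0 z (s : R) : 0 < complex.Im z -> z - s%:C != 0.
Proof. by move=> z0; rewrite -normc_gt0 (lt_le_trans z0)// Im_le_normc_subr. Qed.

Lemma normc_resolvent z (s : R) : 0 < complex.Im z ->
  normc ((z - s%:C)^-1) <= (complex.Im z)^-1.
Proof.
move=> z0; rewrite normcV lef_pV2 ?posrE//; first exact: Im_le_normc_subr.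
by rewrite normc_gt0 subr_real_neq0.
Qed.

Lemma cintegrable_resolvent nu z : 0 < complex.Im z ->
  cintegrable nu (fun s => (z - s%:C)^-1).
Proof.
move=> z0; apply: (@cintegrable_bounded _ _ _ (complex.Im z)^-1).
  exact: cmeasurable_resolvent.
by move=> s; exact: normc_resolvent.
Qed.

Lemma cintegrable_resolvent2 nu z w : 0 < complex.Im z -> 0 < complex.Im w ->
  cintegrable nu (fun s => (z - s%:C)^-1 * (w - s%:C)^-1).
Proof.
move=> z0 w0; apply: (@cintegrable_bounded _ _ _ ((complex.Im z)^-1 * (complex.Im w)^-1)).
  by apply: cmeasurableM; exact: cmeasurable_resolvent.
by move=> s; rewrite normcM ler_pM ?normc_ge0 ?normc_resolvent.
Qed.

Lemma prob_total nu : nu [set: borelR] = 1%E.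
Proof. exact: probability_setT. Qed.

Lemma Rintegral_prob_cst nu (r : R) : \int[nu]_(s in setT) r = r.
Proof.
rewrite Rintegral_cst// -[RHS]mulr1; congr (_ * _).
by rewrite -[RHS]/(fine 1%E); congr fine; exact: prob_total. Qed.

Lemma cintegral_prob_cst nu (c : C) : cintegral nu (fun=> c) = c.
Proof. by apply: complex_eqP; rewrite /= Rintegral_prob_cst. Qed.

Lemma integrable_prob_cst nu (r : R) :
  nu.-integrable [set: borelR] (EFin \o (fun=> r)).
Proof. exact: (@integrable_bounded _ _ _ `|r|). Qed.

Lemma normc_cauchy_le nu z : 0 < complex.Im z ->
  normc (cauchy_transform nu z) <= 2 * (complex.Im z)^-1.
Proof.
move=> z0; rewrite -[in leRHS](Rintegral_prob_cst nu (complex.Im z)^-1).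
apply: normc_cintegral_le; first exact: cintegrable_resolvent.
  exact: integrable_prob_cst.
by move=> s; exact: normc_resolvent.
Qed.

(** An integral that vanishes would make the positive function [g] vanish
    almost everywhere, although the total mass is 1. *)
Lemma Rintegral_gt0 nu (g : borelR -> R) : (forall s, 0 < g s) ->
  nu.-integrable [set: borelR] (EFin \o g) -> 0 < \int[nu]_(s in setT) g s.
Proof.
move=> g0 ig; rewrite lt_neqAle Rintegral_ge0 ?andbT; last by move=> s _; rewrite ltW.
apply/eqP => int0.
have Eint0 : (\int[nu]_(s in setT) `|(g s)%:E| = 0)%E.
  rewrite (eq_integral (EFin \o g)); last by move=> s _; rewrite /= ger0_norm// ltW.
  by rewrite -[LHS]fineK; [rewrite [X in X%:E]/= -[fine _]int0|exact: integrable_fin_num].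
have mg : measurable_fun [set: borelR] (EFin \o g) by exact: measurable_int ig.
have /(ae_eq_integral_abs nu measurableT mg) := Eint0.
move=> [A [mA A0 subA]].
have : (nu setT <= nu A)%E.
  apply: le_measure; rewrite ?inE//.
  move=> s _; apply: subA => /(_ I) [] gs0.
  by have := g0 s; rewrite gs0 ltxx.
by have -> := prob_total nu; rewrite A0 lee_fin ler10.
Qed.

Lemma Im_cauchy nu z : 0 < complex.Im z -> complex.Im (cauchy_transform nu z) =
  - (\int[nu]_(s in setT) (complex.Im z / normc (z - s%:C) ^+ 2)).
Proof.
move=> z0; rewrite /cauchy_transform /cintegral /=.
rewrite (@eq_Rintegral _ _ _ nu setT (fun s : borelR => -1 * (complex.Im z / normc (z - s%:C) ^+ 2))).
  rewrite RintegralZl ?mulN1r//.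
  have [_ i2] := cintegrable_resolvent nu z0.
  have := integrableZl measurableT (-1) i2; apply: eq_integrable => // s _.
  by rewrite -EFinM Im_inv !ReImE /= subr0 mulN1r opprK.
by move=> s _; rewrite Im_inv !ReImE /= subr0 mulN1r.
Qed.

Lemma integrable_poisson nu z : 0 < complex.Im z ->
  nu.-integrable [set: borelR] (EFin \o (fun s : borelR => complex.Im z / normc (z - s%:C) ^+ 2)).
Proof.
move=> z0; have [_ i2] := cintegrable_resolvent nu z0.
have := integrableZl measurableT (-1) i2; apply: eq_integrable => // s _.
by rewrite -EFinM Im_inv !ReImE /= subr0 mulN1r opprK.
Qed.

(** On a bounded set away from the real line the Poisson kernel is bounded
    below by one positive function of s. This uniform bound keeps the Cauchy
    transform in a compact subset of the lower half-plane, so that its reciprocal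
    is again a uniform limit of polynomials. *)
Lemma cauchy_Im_le (nu : probability borelR R) (B d : R) : 0 < B -> 0 < d ->
  exists2 k : R, 0 < k & forall z, normc z <= B -> d <= complex.Im z ->
    complex.Im (cauchy_transform nu z) <= - k.
Proof.
move=> B0 d0; pose g := fun s : borelR => d * ((B + `|s|) ^+ 2)^-1.
have g0 s : 0 < g s by rewrite mulr_gt0// invr_gt0 exprn_gt0// ltr_pwDl.
have mg : measurable_fun [set: borelR] g.
  apply: measurable_funM => //; apply: measurable_inv_ge0; first by move=> s; exact: sqr_ge0.
  by apply: measurable_funX; apply: measurable_funD => //; exact: normr_measurable.
have ig : nu.-integrable [set: borelR] (EFin \o g).
  apply: (@integrable_bounded _ _ _ (d * (B ^+ 2)^-1)) => // s.
  rewrite ger0_norm ?(ltW (g0 s))// /g ler_wpM2l ?(ltW d0)//.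
  rewrite lef_pV2 ?posrE ?exprn_gt0 ?ltr_pwDl//.
  by rewrite lerXn2r ?nnegrE ?(ltW B0) ?addr_ge0// ?(ltW B0)// lerDl.
exists (\int[nu]_(s in setT) g s); first exact: Rintegral_gt0.
move=> z zB dz; have z0 : 0 < complex.Im z := lt_le_trans d0 dz.
rewrite Im_cauchy// lerN2; apply: le_Rintegral => //; first exact: integrable_poisson.
move=> s _; rewrite /g; have zs0 : 0 < normc (z - s%:C) by rewrite normc_gt0 subr_real_neq0.
rewrite ler_pM ?invr_ge0 ?sqr_ge0 ?(ltW d0)// lef_pV2 ?posrE ?exprn_gt0// ?ltr_pwDl//.
rewrite lerXn2r ?nnegrE ?normc_ge0 ?addr_ge0 ?(ltW B0)//.
by rewrite (le_trans (normcB _ _))// normc_real lerD2r.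
Qed.

Lemma Im_cauchy_lt0 nu z : 0 < complex.Im z ->
  complex.Im (cauchy_transform nu z) < 0.
Proof.
move=> z0; have B0 : 0 < normc z by rewrite normc_gt0 upper_neq0.
have [k k0 kP] := cauchy_Im_le nu B0 z0.
by rewrite (le_lt_trans (kP _ _ _))// oppr_lt0.
Qed.

Lemma cauchy_neq0 nu z : 0 < complex.Im z -> cauchy_transform nu z != 0.
Proof. by move=> /(Im_cauchy_lt0 nu); apply: contraTneq => ->; rewrite ltxx. Qed.

Lemma Im_F_gt0 nu z : 0 < complex.Im z -> 0 < complex.Im (F_transform nu z).
Proof.
move=> z0; rewrite Im_inv -mulNr divr_gt0 ?oppr_gt0 ?Im_cauchy_lt0//.
by rewrite exprn_gt0// normc_gt0 cauchy_neq0.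
Qed.

Lemma cauchy_resolvent nu z w : 0 < complex.Im z -> 0 < complex.Im w ->
  cauchy_transform nu z - cauchy_transform nu w =
  (w - z) * cintegral nu (fun s => (z - s%:C)^-1 * (w - s%:C)^-1).
Proof.
move=> z0 w0; rewrite -cintegralB; [|exact: cintegrable_resolvent..].
rewrite -cintegralZ; last exact: cintegrable_resolvent2.
apply: eq_cintegral => s; field.
by rewrite !subr_real_neq0.
Qed.

Lemma cintegral_sum (m : {measure set borelR -> \bar R}) N (a : nat -> C)
    (f : nat -> borelR -> C) : (forall i, cintegrable m (f i)) ->
  cintegrable m (fun s => \sum_(i < N) a i * f i s) /\
  cintegral m (fun s => \sum_(i < N) a i * f i s) = \sum_(i < N) a i * cintegral m (f i).
Proof.
move=> fi; elim: N => [|N [IH1 IH2]].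
  have E : (fun s : borelR => \sum_(i < 0) a i * f i s) = (fun s => 0 * f 0%N s).
    by apply/funext => s; rewrite big_ord0 mul0r.
  rewrite E big_ord0 cintegralZ// mul0r; split=> //.
  exact: cintegrableZ.
have E : (fun s : borelR => \sum_(i < N.+1) a i * f i s) =
    (fun s => \sum_(i < N) a i * f i s + a N * f N s).
  by apply/funext => s; rewrite big_ord_recr.
rewrite E big_ord_recr /=; split; first by apply: cintegrableD => //; exact: cintegrableZ.
by rewrite cintegralD ?IH2 ?cintegralZ//; exact: cintegrableZ.
Qed.

(** The geometric series of the resolvent converges uniformly in s, hence may
    be integrated term by term. *)
Lemma approximable_cauchy nu (c : C) (r : R) : 0 <= r -> r < complex.Im c ->
  approximable (cdisc c r) (cauchy_transform nu).
Proof.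
move=> r0 rc e e0; have c0 : 0 < complex.Im c := le_lt_trans r0 rc.
have [||N xN] := @expr_small _ (r / complex.Im c) (e / 2 * (complex.Im c - r)).
- by rewrite divr_ge0 ?(ltW c0)//= ltr_pdivrMr// mul1r.
- by rewrite mulr_gt0 ?divr_gt0// subr_gt0.
pose f (i : nat) (s : borelR) := (c - s%:C)^-1 ^+ i.+1.
have fi i : cintegrable nu (f i).
  apply: (@cintegrable_bounded _ _ _ ((complex.Im c)^-1 ^+ i.+1)).
    elim: i => [|i IHi]; first exact: cmeasurable_resolvent.
    apply: (@eq_cmeasurable _ (fun s => (c - s%:C)^-1 * f i s)).
      by move=> s; rewrite /f [RHS]exprS.
    by apply: cmeasurableM => //; exact: cmeasurable_resolvent.
  move=> s; rewrite normcX lerXn2r ?nnegrE ?normc_ge0 ?invr_ge0 ?(ltW c0)//.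
  exact: normc_resolvent.
exists (\sum_(i < N) (- ('X - c%:P)) ^+ i * (cintegral nu (f i))%:P) => z zc.
have z0 : 0 < complex.Im z.
  have := le_trans (normr_Im_le _) zc; rewrite !ReImE => h.
  have := ler_norm (- (complex.Im z - complex.Im c)); rewrite normrN; move: h rc; lra.
rewrite horner_sum; under eq_bigr do rewrite !hornerE.
have [i1 <-] := cintegral_sum N (fun i => (- (z - c)) ^+ i) fi.
rewrite -cintegralB//; last exact: cintegrable_resolvent.
have -> : e = 2 * (e / 2) by rewrite mulrC divfK.
rewrite -[in leRHS](Rintegral_prob_cst nu (e / 2)).
apply: normc_cintegral_le; last 1 first.
- move=> s; have kc : complex.Im c <= normc (c - s%:C) by exact: Im_le_normc_subr.
  have := normc_resolvent_le N rc kc zc => h.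
  by rewrite (le_trans h)// ler_pdivrMr// subr_gt0.
- have := cintegrableD (cintegrable_resolvent nu z0) (cintegrableZ (-1) i1).
  by congr cintegrable; apply/funext => s; rewrite mulN1r.
- exact: integrable_prob_cst.
Qed.

End CauchyTransform.

(** * Injectivity of the reciprocal Cauchy transform near infinity *)

Section Subordination.
Variable R : realType.
Local Notation C := R[i].
Local Notation borelR := (measurableTypeR R).
Implicit Types (mu nu : probability borelR R) (z : C).

Definition stolz_infinity (A : R) (w : nat -> C) : Prop :=
  (\forall n \near \oo, 0 < complex.Im (w n) /\
     `|complex.Re (w n)| <= A * complex.Im (w n)) /\
  (fun n => (complex.Im (w n))^-1) @ \oo --> (0 : R).

Lemma stolz_ratio_le A z (s : R) : 0 < complex.Im z ->
  `|complex.Re z| <= A * complex.Im z -> normc (z * (z - s%:C)^-1) <= A + 1.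
Proof.
move=> z0 zA; rewrite normcM normcV ler_pdivrMr ?normc_gt0 ?subr_real_neq0//.
have nz : normc z <= (A + 1) * complex.Im z.
  by rewrite (le_trans (normc_le_ReIm _))// mulrDl mul1r (gtr0_norm z0) lerD2r.
apply: le_trans nz _; rewrite ler_wpM2l ?Im_le_normc_subr//.
have : 0 <= A * complex.Im z by exact: le_trans zA.
by rewrite pmulr_lge0// => A0; rewrite addr_ge0.
Qed.

Lemma stolz_ratio_cvg A w (s : R) : stolz_infinity A w ->
  ctends (fun n => w n * (w n - s%:C)^-1) 1.
Proof.
move=> [wA w0].
apply: (@ctends_squeeze _ _ _ (fun n => `|s| * (complex.Im (w n))^-1)).
  apply: filterS wA => n [wn0 _].
  have wns := subr_real_neq0 s wn0.
  have -> : w n * (w n - s%:C)^-1 - 1 = s%:C * (w n - s%:C)^-1.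
    by apply: (mulIf wns); rewrite mulrBl !mulfVK// mul1r opprB addrC subrK.
  by rewrite normcM normc_real ler_wpM2l// normc_resolvent.
by rewrite -(mulr0 `|s|); apply: cvgM => //; exact: cvg_cst.
Qed.

(** By the resolvent identity, this limit says that the Cauchy transform is
    injective far out in a cone: two distinct points with the same value would
    make the integral vanish. *)
Lemma stolz_resolvent_pair nu A B v w : stolz_infinity A v -> stolz_infinity B w ->
  ctends (fun n => v n * w n *
    cintegral nu (fun s => (v n - s%:C)^-1 * (w n - s%:C)^-1)) 1.
Proof.
move=> vA wB; have [[N1 _ N1v] _] := vA; have [[N2 _ N2w] _] := wB.
pose f n (s : borelR) := v n * (v n - s%:C)^-1 * (w n * (w n - s%:C)^-1).
have A1 : 0 <= A + 1.
  have [v0 vn] := N1v N1 (leqnn _).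
  by apply: le_trans (stolz_ratio_le 0 v0 vn); exact: normc_ge0.
have [|||||_] := @cintegral_dominated R nu f (fun=> 1) (fun=> ((A + 1) * (B + 1))%:E)
   (maxn N1 N2).
- move=> n; apply: cmeasurableM;
    (apply: cmeasurableM; [exact: cmeasurable_cst|exact: cmeasurable_resolvent]).
- exact: cmeasurable_cst.
- exact: integrable_prob_cst.
- apply: aeW => s; rewrite -[X in ctends _ X](mulr1 1).
  by apply: ctendsM; [exact: stolz_ratio_cvg vA|exact: stolz_ratio_cvg wB].
- apply: aeW => s n; rewrite geq_max => /andP[n1 n2]; rewrite lee_fin normcM.
  have [v0 vn] := N1v n n1; have [w0 wn] := N2w n n2.
  by rewrite ler_pM ?normc_ge0 ?stolz_ratio_le.
rewrite cintegral_prob_cst; apply: ctends_near.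
exists (maxn N1 N2) => // n /=; rewrite geq_max => /andP[n1 n2].
have [v0 vn] := N1v n n1; have [w0 wn] := N2w n n2.
rewrite -cintegralZ; last exact: cintegrable_resolvent2.
by apply: eq_cintegral => s; rewrite /f mulrACA.
Qed.

Lemma stolz_cauchy nu A w : stolz_infinity A w ->
  ctends (fun n => w n * cauchy_transform nu (w n)) 1.
Proof.
move=> wA; have [[N _ Nw] _] := wA.
pose f n (s : borelR) := w n * (w n - s%:C)^-1.
have [|||||_] := @cintegral_dominated R nu f (fun=> 1) (fun=> (A + 1)%:E) N.
- by move=> n; apply: cmeasurableM; [exact: cmeasurable_cst|exact: cmeasurable_resolvent].
- exact: cmeasurable_cst.
- exact: integrable_prob_cst.
- by apply: aeW => s; exact: stolz_ratio_cvg wA.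
- apply: aeW => s n /Nw[w0 wn]; rewrite lee_fin.
  exact: stolz_ratio_le.
rewrite cintegral_prob_cst; apply: ctends_near.
exists N => // n /= /Nw[w0 wn].
by rewrite cintegralZ//; exact: cintegrable_resolvent.
Qed.

Lemma stolz_perturb A u (w z : C) : 0 < complex.Im w ->
  `|complex.Re w| <= A * complex.Im w ->
  normc (z / w - 1) * (A + 1) <= u ->
  (1 - u) * complex.Im w <= complex.Im z /\
  `|complex.Re z| <= (A + u) * complex.Im w.
Proof.
move=> w0 wA zu; have wn0 := upper_neq0 w0.
have zw : normc (z - w) <= u * complex.Im w.
  have -> : z - w = (z / w - 1) * w by rewrite mulrBl mulfVK// mul1r.
  have nw : normc w <= (A + 1) * complex.Im w.
    by rewrite (le_trans (normc_le_ReIm _))// mulrDl mul1r (gtr0_norm w0) lerD2r.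
  rewrite normcM; apply: le_trans (ler_wpM2l (normc_ge0 _) nw) _.
  by rewrite mulrA ler_wpM2r// ltW.
have [r1 i1] := (le_trans (normr_Re_le _) zw, le_trans (normr_Im_le _) zw).
rewrite !ReImE in r1 i1; split.
  rewrite mulrBl mul1r lerBlDr -lerBlDl (le_trans _ i1)// distrC.
  exact: ler_norm.
rewrite -[complex.Re z](subrK (complex.Re w)) mulrDl addrC.
by rewrite (le_trans (ler_normD _ _))// lerD.
Qed.

Lemma ctends_ratio_small z (v w : nat -> C) (k e : R) : 0 < k -> 0 < e ->
  ctends (fun n => v n / w n) 1 ->
  exists N, forall n, (N <= n)%N -> normc (v n / w n - 1) * k <= e.
Proof.
move=> k0 e0 /ctendsP /cvgrPdist_le /(_ _ (divr_gt0 e0 k0)) [N _ NP].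
exists N => n /NP; rewrite sub0r normrN ger0_norm ?normc_ge0//.
by rewrite ler_pdivlMr.
Qed.

Lemma stolz_infinity_ratio A v w : 0 <= A -> stolz_infinity A w ->
  ctends (fun n => v n / w n) 1 -> stolz_infinity (2 * A + 1) v.
Proof.
move=> A0 [[N1 _ N1w] w0] vw.
have A1 : 0 < A + 1 by rewrite ltr_wpDl.
have [N2 N2v] := ctends_ratio_small 0 A1 (divr_gt0 ltr01 (ltr0Sn R 1)) vw.
have P n : (maxn N1 N2 <= n)%N -> [/\ 0 < complex.Im (w n),
    1 / 2 * complex.Im (w n) <= complex.Im (v n) &
    `|complex.Re (v n)| <= (A + 1 / 2) * complex.Im (w n)].
  rewrite geq_max => /andP[/N1w[wn0 wA] /N2v h].
  have [h1 h2] := stolz_perturb wn0 wA h; split=> //.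
  by apply: le_trans h1; rewrite ler_wpM2r ?(ltW wn0)//; lra.
split.
  exists (maxn N1 N2) => // n /P[wn0 h1 h2]; split.
    by rewrite (lt_le_trans _ h1)// mulr_gt0// divr_gt0.
  apply: (le_trans h2); move: A0 h1; nra.
apply: (@squeeze_cvgr _ _ _ _ (cst 0) (fun n => 2 * (complex.Im (w n))^-1)).
- exists (maxn N1 N2) => // n /P[wn0 h1 h2] /=.
  have vn0 : 0 < complex.Im (v n) by rewrite (lt_le_trans _ h1)// mulr_gt0// divr_gt0.
  rewrite invr_ge0 (ltW vn0)/= -[X in X * _]invrK -invfM lef_pV2 ?posrE//.
    by rewrite -[2^-1]mul1r.
  by rewrite mulr_gt0// invr_gt0.
- exact: cvg_cst.
by rewrite -(mulr0 2); apply: cvgM => //; exact: cvg_cst.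
Qed.

(** A right inverse [H] of [F] with [H z / z] tending to 1 is also a left
    inverse far out in a cone. Otherwise there are points w tending to infinity
    such that w and [H (F w)] are distinct and have the same image under [F].
    Both sequences are asymptotic to each other, which contradicts
    [stolz_resolvent_pair]. *)
Lemma right_inverse_far nu (a b : R) H : 0 < a -> 0 < b ->
  F_right_inverse nu a b H ->
  exists M : R, forall w, `|complex.Re w| <= a / 2 * complex.Im w ->
    M <= complex.Im w ->
    truncated_cone a b (F_transform nu w) /\ H (F_transform nu w) = w.
Proof.
move=> a0 b0 [HF Hinf]; apply: contrapT => noM.
have bad n : exists w : C, [/\ `|complex.Re w| <= a / 2 * complex.Im w,
    n.+1%:R <= complex.Im w &
    ~ (truncated_cone a b (F_transform nu w) /\ H (F_transform nu w) = w)].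
  apply: contrapT => nw; apply: noM; exists n.+1%:R => w wa wn.
  by apply: contrapT => nt; apply: nw; exists w.
have [w wP] := choice bad.
have w0 n : 0 < complex.Im (w n) by have [_ h _] := wP n; exact: lt_le_trans h.
have winf : (fun n => (complex.Im (w n))^-1) @ \oo --> (0 : R).
  apply: (@squeeze_cvgr _ _ _ _ (cst 0) (@harmonic R)).
  - near=> n; rewrite /= invr_ge0 (ltW (w0 n)) /= lef_pV2 ?posrE//.
    by have [] := wP n.
  - exact: cvg_cst.
  - exact: cvg_harmonic.
have wS : stolz_infinity (a / 2) w.
  split=> //; near=> n; split=> //; by have [] := wP n.
pose z n := F_transform nu (w n).
have zw : ctends (fun n => z n / w n) 1.
  have := ctendsV (oner_neq0 _) (stolz_cauchy nu wS); rewrite invr1.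
  by apply: eq_ctends => n; rewrite invfM mulrC.
have a2 : 0 <= a / 2 by rewrite divr_ge0// ltW.
(* u is the largest relative error for which a perturbation of a point of the
   cone of slope a / 2 stays in the cone of slope a *)
pose u := a / (2 * (1 + a)).
have u0 : 0 < u by rewrite divr_gt0// mulr_gt0// addr_gt0.
have ua : u * (1 + a) = a / 2 by rewrite /u; field; move: a0; lra.
have u12 : u < 1 / 2 by rewrite ltr_pdivrMr ?mulr_gt0 ?addr_gt0//; move: a0; lra.
have [N1 N1z] := ctends_ratio_small 0 (ltr_wpDl a2 ltr01) u0 zw.
have [N2 N2b] : exists N : nat, forall n, (N <= n)%N -> 2 * b <= n.+1%:R.
  exists (Num.truncn (2 * b)) => n Nn.
  apply: le_trans (ltW (truncnS_gt _)) _; by rewrite ler_nat ltnS.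
have zcone n : (maxn N1 N2 <= n)%N -> truncated_cone a b (z n).
  rewrite geq_max => /andP[n1 n2].
  have [wa wn _] := wP n; have [h1 h2] := stolz_perturb (w0 n) wa (N1z n n1).
  have wb := le_trans (N2b n n2) wn; split.
    apply: (le_trans h2); have := w0 n; have au : a / 2 + u = a * (1 - u) by move: ua; lra.
    by rewrite au -mulrA => _; rewrite ler_wpM2l// ltW.
  by apply: le_trans h1; have := w0 n; move: wb u12 u0; nra.
pose v n := H (z n).
have vz : ctends (fun n => v n / z n) 1.
  apply/ctendsP/cvgrPdist_lt => e e0; have [M MP] := Hinf e e0.
  have [N3 N3b] : exists N : nat, forall n, (N <= n)%N -> 2 * M <= n.+1%:R.
    exists (Num.truncn (2 * `|M|)) => n Nn.
    apply: (@le_trans _ _ (2 * `|M|)); first by rewrite ler_wpM2l// ler_norm.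
    apply: le_trans (ltW (truncnS_gt _)) _; by rewrite ler_nat ltnS.
  exists (maxn (maxn N1 N2) N3) => // n /=; rewrite geq_max => /andP[n12 n3].
  rewrite sub0r normrN ger0_norm ?normc_ge0//.
  have := MP _ (zcone n n12); rewrite normr_normc lecR normr_normc ltcR; apply.
  move: n12; rewrite geq_max => /andP[n1 n2].
  have [wa wn _] := wP n; have [h1 h2] := stolz_perturb (w0 n) wa (N1z n n1).
  apply: le_trans (Im_le_normc _); apply: le_trans h1.
  have := w0 n; have := le_trans (N3b n n3) wn; move: u12 u0; nra.
have zn0 n : z n != 0 by rewrite invr_eq0 cauchy_neq0.
have vw : ctends (fun n => v n / w n) 1.
  have := ctendsM vz zw; rewrite mulr1; apply: eq_ctends => n.
  by rewrite mulrA mulfVK.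
have vS := stolz_infinity_ratio a2 wS vw.
have /ctendsP /cvgrPdist_lt /(_ 1 ltr01) [N3 _ N3P] := stolz_resolvent_pair nu vS wS.
pose n := maxn (maxn N1 N2) N3.
have zn := zcone n (leq_maxl _ _).
have [_ _ nbad] := wP n; apply: nbad; split=> //.
have [vn0 Fv] := HF _ zn.
have Gvw : cauchy_transform nu (v n) = cauchy_transform nu (w n).
  by apply: invr_inj; exact: Fv.
have := cauchy_resolvent nu vn0 (w0 n); rewrite Gvw subrr => /esym/eqP.
rewrite mulf_eq0 subr_eq0 => /orP[/eqP wv|/eqP I0].
  exact: esym.
have := N3P n (leq_maxr _ _); rewrite I0 mulr0 sub0r normrN.
by rewrite sub0r normcN ComplexField.Normc.normc1 normr1 ltxx.
Unshelve. all: by end_near. Qed.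

End Subordination.

(** * The subordination identity on the upper half-plane *)

Section SubordinationGlobal.
Variable R : realType.
Local Notation C := R[i].
Local Notation borelR := (measurableTypeR R).
Implicit Types (mu nu : probability borelR R) (z w : C).

(** The subordination function of the free power [nu] of exponent p: it maps
    the upper half-plane to itself, and composing [F_transform mu] with it gives
    [F_transform nu]. *)
Definition subordination (p : R) nu z : C :=
  (p^-1)%:C * z + (1 - p^-1)%:C * F_transform nu z.

Lemma Im_subordination p nu z : complex.Im (subordination p nu z) =
  p^-1 * complex.Im z + (1 - p^-1) * complex.Im (F_transform nu z).
Proof. by rewrite !ReImE /= !mul0r !addr0. Qed.

Lemma Im_subordination_ge p nu z : 1 < p -> 0 < complex.Im z ->
  p^-1 * complex.Im z <= complex.Im (subordination p nu z).
Proof.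
move=> p1 z0; rewrite Im_subordination lerDl mulr_ge0 ?(ltW (Im_F_gt0 nu z0))//.
by rewrite subr_ge0 invf_le1 ?ltW// (lt_trans ltr01).
Qed.

Lemma Im_subordination_gt0 p nu z : 1 < p -> 0 < complex.Im z ->
  0 < complex.Im (subordination p nu z).
Proof.
move=> p1 z0; apply: lt_le_trans (Im_subordination_ge nu p1 z0).
by rewrite mulr_gt0// invr_gt0 (lt_trans ltr01).
Qed.

(** A bounded part of the half-plane at height at least d lies in a disc
    that stays away from the real line. The power series of a Cauchy transform is
    controlled on discs only. *)
Lemma upper_disc_cover (B d Y : R) z : 0 < d -> d < Y -> B ^+ 2 <= Y * d ->
  normc z <= B -> d <= complex.Im z -> cdisc (0 +i* Y) (Y - d / 2) z.
Proof.
move=> d0 dY BY zB dz; rewrite /cdisc /=.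
have r0 : 0 <= Y - d / 2 by move: d0 dY; lra.
rewrite -(ler_pXn2r (n := 2)) ?nnegrE ?normc_ge0// normc_sqr !ReImE /= subr0.
have z2 : complex.Re z ^+ 2 + complex.Im z ^+ 2 <= B ^+ 2.
  by rewrite -normc_sqr lerXn2r ?nnegrE ?normc_ge0// (le_trans (normc_ge0 z)).
by move: z2 BY dY d0 dz; set x := complex.Re z; set y := complex.Im z; nra.
Qed.

(** The values of the Cauchy transform are reflected into the upper half-plane
    to place them in a disc that avoids 0; there [approximable_inv] applies. *)
Lemma approximable_F nu (D : set C) (B d : R) : 0 < B -> 0 < d ->
  (forall z, D z -> normc z <= B /\ d <= complex.Im z) ->
  approximable D (cauchy_transform nu) ->
  approximable D (F_transform nu) /\
  exists B', forall z, D z -> normc (F_transform nu z) <= B'.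
Proof.
move=> B0 d0 DP aG; have [k k0 kP] := cauchy_Im_le nu B0 d0.
have z0 z : D z -> 0 < complex.Im z by move=> /DP[_]; exact: lt_le_trans.
pose B1 := 2 * d^-1; pose Y := 1 + k + B1 ^+ 2 / k.
have B10 : 0 <= B1 by rewrite mulr_ge0// invr_ge0 ltW.
have GB z : D z -> normc (cauchy_transform nu z) <= B1.
  move=> Dz; apply: le_trans (normc_cauchy_le nu (z0 _ Dz)) _.
  by rewrite ler_wpM2l// lef_pV2 ?posrE ?z0//; case: (DP _ Dz).
have Bk0 : 0 <= B1 ^+ 2 / k by rewrite divr_ge0 ?sqr_ge0// ltW.
have kY : k < Y by move: Bk0; rewrite /Y; lra.
have BY : B1 ^+ 2 <= Y * k.
  by rewrite /Y mulrDl mulfVK ?gt_eqF// lerDr mulr_ge0 ?addr_ge0// ltW.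
have Y0 : 0 < Y := lt_trans k0 kY.
split.
  apply: (@approximable_comp _ _ (cdisc (0 +i* (- Y)) (Y - k / 2))
    (Y - k / 2 + normc (0 +i* (- Y))) (fun z => z^-1)) aG => /=.
  - by move=> z; exact: cdisc_bounded.
  - move=> z Dz; have [zB dz] := DP _ Dz.
    have := @upper_disc_cover _ _ _ (- cauchy_transform nu z) k0 kY BY.
    rewrite normcN Im_opp => /(_ (GB _ Dz)); rewrite lerNr => /(_ (kP _ zB dz)).
    have E : normc (- cauchy_transform nu z - (0 +i* Y)) =
        normc (cauchy_transform nu z - (0 +i* (- Y))).
      by rewrite -normcN; congr normc; apply: complex_eqP; rewrite !ReImE /=; ring.
    by move=> h; have : normc (- cauchy_transform nu z - (0 +i* Y)) <= Y - k / 2 := h;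
      rewrite E.
  - apply: approximable_inv; first by move: k0 kY; lra.
    rewrite /= expr0n add0r sqrrN sqrtr_sqr gtr0_norm//.
    by rewrite gtrBl divr_gt0.
exists k^-1 => z Dz; have [zB dz] := DP _ Dz.
rewrite normcV lef_pV2 ?posrE ?normc_gt0 ?cauchy_neq0 ?z0//.
apply: le_trans (normr_Im_le _); rewrite -normrN (le_trans _ (ler_norm _))//.
by rewrite lerNr kP.
Qed.

Lemma approximable_cauchy_comp mu (D : set C) (g : C -> C) (B d : R) : 0 < d ->
  (forall z, D z -> normc (g z) <= B /\ d <= complex.Im (g z)) ->
  approximable D g -> approximable D (fun z => cauchy_transform mu (g z)).
Proof.
move=> d0 DP ag; pose Y := 1 + d + B ^+ 2 / d.
have Bd0 : 0 <= B ^+ 2 / d by rewrite divr_ge0 ?sqr_ge0// ltW.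
have dY : d < Y by move: Bd0; rewrite /Y; lra.
have BY : B ^+ 2 <= Y * d.
  by rewrite /Y mulrDl mulfVK ?gt_eqF// lerDr mulr_ge0 ?addr_ge0// ltW.
apply: (@approximable_comp _ _ (cdisc (0 +i* Y) (Y - d / 2))
  (Y - d / 2 + normc (0 +i* Y))) ag => /=.
- by move=> z; exact: cdisc_bounded.
- by move=> z /DP[zB dz]; exact: upper_disc_cover zB dz.
- apply: approximable_cauchy => /=; first by move: d0 dY; lra.
  by rewrite gtrBl divr_gt0.
Qed.

(** The relation between the Voiculescu transforms, read at [F_transform nu w]
    instead of w. *)
Lemma F_subordination_far mu nu p : 1 < p -> free_power p mu nu ->
  exists2 a : R, 0 < a & exists M : R, forall w,
    `|complex.Re w| <= a * complex.Im w -> M <= complex.Im w ->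
    F_transform mu (subordination p nu w) = F_transform nu w.
Proof.
move=> p1 [a [b [a0 b0 [phi [psi [[Hmu [HF _] phiE] [Hnu Hn psiE] pp]]]]]].
have [M MP] := right_inverse_far a0 b0 Hn.
exists (a / 2); first by rewrite divr_gt0.
exists M => w wa wM; have [zc Hz] := MP w wa wM.
have [_ <-] := HF _ zc; congr (F_transform mu _).
have := pp _ zc; rewrite psiE// phiE// Hz.
set z := F_transform nu w; set h := Hmu z => E.
have p0 : p%:C != 0 by rewrite eq_complex /= eqxx andbT gt_eqF// (lt_trans ltr01).
rewrite /subordination -/z rmorphB rmorph1 fmorphV.
have -> : w = p%:C * (h - z) + z by rewrite -E subrK.
by field.
Qed.

(** Every point z of the half-plane lies in a disc whose centre c is so high
    on the imaginary axis that a small disc around c is contained in the region of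
    [F_subordination_far]. Both sides are uniform limits of polynomials on the
    large disc, and the identity theorem carries the equality over to z. *)
Lemma F_subordination mu nu p z : 1 < p -> free_power p mu nu ->
  0 < complex.Im z -> F_transform mu (subordination p nu z) = F_transform nu z.
Proof.
move=> p1 fp z0; have [a a0 [M MP]] := F_subordination_far p1 fp.
have p0 : 0 < p by exact: lt_trans p1.
pose eta := complex.Im z.
pose Y := 2 + `|M| + eta + normc z ^+ 2 / eta.
have zz0 : 0 <= normc z ^+ 2 / eta by rewrite divr_ge0 ?sqr_ge0// ltW.
have M0 : 0 <= `|M| by [].
have MM : M <= `|M| := ler_norm M.
have Y2 : 2 + `|M| + eta <= Y by rewrite lerDl.
pose c : C := 0 +i* Y.
pose r1 := Y - eta / 4.
pose D := cdisc c r1.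
have DIm w : D w -> eta / 4 <= complex.Im w.
  move=> /(le_trans (normr_Im_le _)); rewrite !ReImE /= distrC.
  by move=> /(le_trans (ler_norm _)); rewrite /r1; lra.
have e40 : 0 < eta / 4 by rewrite divr_gt0.
have DP w : D w -> normc w <= r1 + normc c /\ eta / 4 <= complex.Im w.
  by move=> Dw; split; [exact: cdisc_bounded|exact: DIm].
have r10 : 1 <= r1 by move: Y2 M0 e40; rewrite /r1; lra.
have B0 : 0 < r1 + normc c by rewrite ltr_pwDl ?normc_ge0// (lt_le_trans ltr01).
have aG : approximable D (cauchy_transform nu).
  apply: approximable_cauchy => /=; first by rewrite (le_trans ler01).
  by rewrite gtrBl.
have [aF [B' FB]] := approximable_F B0 e40 DP aG.
have aS : approximable D (subordination p nu).
  apply: approximableD; apply: approximableZ => //.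
  exact: approximable_id.
have SB w : D w -> normc (subordination p nu w) <=
    p^-1 * (r1 + normc c) + `|1 - p^-1| * B' /\
    p^-1 * (eta / 4) <= complex.Im (subordination p nu w).
  move=> Dw; have [wB wI] := DP _ Dw; have wF := FB _ Dw; split.
    rewrite (le_trans (normcD _ _))// !normcM !normc_real gtr0_norm ?invr_gt0//.
    by rewrite lerD// ler_wpM2l ?invr_ge0 ?(ltW p0).
  have w0 : 0 < complex.Im w by exact: lt_le_trans wI.
  by apply: le_trans (Im_subordination_ge nu p1 w0); rewrite ler_wpM2l ?invr_ge0 ?(ltW p0).
have pe0 : 0 < p^-1 * (eta / 4) by rewrite mulr_gt0 ?invr_gt0.
have aGS := approximable_cauchy_comp mu pe0 SB aS.
have aPhi := approximableD aGS (approximableZ (-1) aG).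
pose r0 := Num.min 1 (a / (1 + a)).
have r00 : 0 < r0 by rewrite lt_min ltr01 divr_gt0// addr_gt0.
have r01 : r0 <= 1 by rewrite ge_min lexx.
have r0a : r0 * (1 + a) <= a.
  by rewrite -ler_pdivlMr ?addr_gt0// ge_min lexx orbT.
have near_c w : cdisc c r0 w -> cauchy_transform mu (subordination p nu w) +
    -1 * cauchy_transform nu w = 0.
  move=> wc; have wRe := le_trans (normr_Re_le _) wc.
  have wIm := le_trans (normr_Im_le _) wc.
  rewrite !ReImE /= subr0 in wRe; rewrite !ReImE /= distrC in wIm.
  have wI := le_trans (ler_norm _) wIm.
  have wM : M <= complex.Im w by move: wI r01 Y2 MM z0; rewrite -/eta; lra.
  have wa : `|complex.Re w| <= a * complex.Im w.
    apply: (le_trans wRe); have : 1 <= complex.Im w.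
      by move: wI r01 Y2 M0 z0; rewrite -/eta; lra.
    by move: r0a r01 r00 a0; nra.
  have /invr_inj -> := MP w wa wM.
  by rewrite mulN1r subrr.
(* the term normc z ^+ 2 / eta in Y serves here: it puts z in the disc *)
have zD : normc (z - c) < r1.
  have zY : normc z ^+ 2 <= Y * eta.
    rewrite /Y mulrDl mulfVK ?gt_eqF// lerDr mulr_ge0 ?(ltW z0)//.
    by rewrite !addr_ge0// ltW.
  have eY : eta < Y by move: Y2 M0; lra.
  apply: (le_lt_trans (upper_disc_cover z0 eY zY (lexx _) (lexx _))).
  by move: e40; rewrite /r1 -/eta; lra.
have := approximable_identity r00 (le_trans r01 r10) aPhi near_c zD.
rewrite mulN1r => /eqP; rewrite subr_eq0 => /eqP GG.
by rewrite /F_transform GG.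
Qed.

End SubordinationGlobal.

(** * The Nevanlinna representation and the inverse of the subordination function *)

Section Nevanlinna.
Variable R : realType.
Local Notation C := R[i].
Local Notation borelR := (measurableTypeR R).
Variable rho : {finite_measure set borelR -> \bar R}.
Implicit Types (z w : C).

Definition nevanlinna_kernel z w (s : borelR) : C :=
  (s ^+ 2 + 1)%:C * ((s%:C - z)^-1 * (s%:C - w)^-1).

Definition weighted_poisson z (s : borelR) : R :=
  (s ^+ 2 + 1) / normc (s%:C - z) ^+ 2.

Definition poisson_mass z : R := \int[rho]_(s in setT) weighted_poisson z s.

Lemma weighted_poisson_ge0 z s : 0 <= weighted_poisson z s.
Proof. by rewrite divr_ge0 ?sqr_ge0// addr_ge0 ?sqr_ge0. Qed.

Lemma cmeasurable_resolventN z : cmeasurable (fun s : borelR => (s%:C - z)^-1).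
Proof.
apply: cmeasurableV; apply: cmeasurableB; last exact: cmeasurable_cst.
exact: cmeasurable_id.
Qed.

Lemma measurable_weight : measurable_fun [set: borelR] (fun s : borelR => s ^+ 2 + 1).
Proof. by apply: measurable_funD => //; exact: measurable_funX. Qed.

Lemma cmeasurable_kernel z w : cmeasurable (nevanlinna_kernel z w).
Proof.
apply: cmeasurableM; first exact: (cmeasurable_real measurable_weight).
by apply: cmeasurableM; exact: cmeasurable_resolventN.
Qed.

Lemma measurable_weighted_poisson z : measurable_fun [set: borelR] (weighted_poisson z).
Proof.
apply: measurable_funM; first exact: measurable_weight.
apply: measurable_inv_ge0; first by move=> s; exact: sqr_ge0.
apply: cmeasurable_normc2; apply: cmeasurableB; last exact: cmeasurable_cst.
exact: cmeasurable_id.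
Qed.

Lemma real_subr_neq0 z (s : R) : 0 < complex.Im z -> s%:C - z != 0.
Proof. by move=> z0; rewrite -opprB oppr_eq0 subr_real_neq0. Qed.

Lemma Im_le_normc_real_subr z (s : R) : complex.Im z <= normc (s%:C - z).
Proof. by rewrite normc_distC Im_le_normc_subr. Qed.

Definition poisson_bound z : R := (1 + normc (z - (0 +i* 1)) / complex.Im z) ^+ 2.

(** The weight [s ^+ 2 + 1] is the squared distance from s to the imaginary
    unit. *)
Lemma weighted_poisson_le z s : 0 < complex.Im z ->
  weighted_poisson z s <= poisson_bound z.
Proof.
move=> z0; have zs0 : 0 < normc (s%:C - z) by rewrite normc_gt0 real_subr_neq0.
have -> : weighted_poisson z s = (normc (s%:C - (0 +i* 1)) / normc (s%:C - z)) ^+ 2.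
  rewrite expr_div_n normc_sqr !ReImE /=; congr (_ / _).
  by rewrite subr0 sub0r sqrrN expr1n.
rewrite lerXn2r ?nnegrE ?divr_ge0 ?normc_ge0 ?addr_ge0 ?divr_ge0 ?normc_ge0 ?(ltW z0)//.
have -> : s%:C - (0 +i* 1) = (s%:C - z) + (z - (0 +i* 1)) by rewrite addrA subrK.
apply: (@le_trans _ _ ((normc (s%:C - z) + normc (z - (0 +i* 1))) / normc (s%:C - z))).
  by rewrite ler_wpM2r ?invr_ge0 ?normc_ge0// normcD.
rewrite mulrDl divff ?gt_eqF// lerD2l ler_wpM2l ?normc_ge0//.
by rewrite lef_pV2 ?posrE// Im_le_normc_real_subr.
Qed.

Lemma integrable_weighted_poisson z : 0 < complex.Im z ->
  rho.-integrable [set: borelR] (EFin \o weighted_poisson z).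
Proof.
move=> z0; apply: (@integrable_bounded _ _ _ (poisson_bound z)).
  exact: measurable_weighted_poisson.
by move=> s; rewrite ger0_norm ?weighted_poisson_ge0// weighted_poisson_le.
Qed.

Lemma normc_kernel_le z w s : normc (nevanlinna_kernel z w s) <=
  2^-1 * (weighted_poisson z s + weighted_poisson w s).
Proof.
have s0 : 0 <= s ^+ 2 + 1 by rewrite addr_ge0 ?sqr_ge0.
rewrite !normcM !normcV normc_real ger0_norm// /weighted_poisson -mulrDr -!exprVn.
rewrite [leRHS]mulrCA ler_wpM2l//.
by set a := _^-1; set b := _^-1; have := sqr_ge0 (a - b); nra.
Qed.

Lemma cintegrable_kernel z w : 0 < complex.Im z -> 0 < complex.Im w ->
  cintegrable rho (nevanlinna_kernel z w).
Proof.
move=> z0 w0; apply: (@cintegrable_bounded _ _ _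
  (2^-1 * (poisson_bound z + poisson_bound w))); first exact: cmeasurable_kernel.
move=> s; apply: le_trans (normc_kernel_le _ _ _) _.
by rewrite ler_wpM2l ?invr_ge0// lerD ?weighted_poisson_le.
Qed.

Lemma Re_cintegral_kernel_le z w : 0 < complex.Im z -> 0 < complex.Im w ->
  complex.Re (cintegral rho (nevanlinna_kernel z w)) <=
  2^-1 * (poisson_mass z + poisson_mass w).
Proof.
move=> z0 w0; have [iz iw] := (integrable_weighted_poisson z0, integrable_weighted_poisson w0).
have iD : rho.-integrable [set: borelR]
    (EFin \o (fun s => weighted_poisson z s + weighted_poisson w s)).
  by have := integrableD measurableT iz iw; apply: eq_integrable.
rewrite -RintegralD// -RintegralZl//=; apply: le_Rintegral => //.
- by have [] := cintegrable_kernel z0 w0.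
- exact: integrableZl_EFin iD.
by move=> s _; exact: le_trans (Re_le_normc _) (normc_kernel_le _ _ _).
Qed.

Lemma cmeasurable_nevanlinna z :
  cmeasurable (fun s : borelR => (1 + s%:C * z) / (s%:C - z)).
Proof.
apply: cmeasurableM; last exact: cmeasurable_resolventN.
apply: cmeasurableD; first exact: cmeasurable_cst.
by apply: cmeasurableM; [exact: cmeasurable_id|exact: cmeasurable_cst].
Qed.

Lemma cintegrable_nevanlinna z : 0 < complex.Im z ->
  cintegrable rho (fun s => (1 + s%:C * z) / (s%:C - z)).
Proof.
move=> z0; apply: (@cintegrable_bounded _ _ _
   (normc z + normc (1 + z ^+ 2) * (complex.Im z)^-1)).
  exact: cmeasurable_nevanlinna.
move=> s; have zs := real_subr_neq0 s z0.
have -> : (1 + s%:C * z) / (s%:C - z) = z + (1 + z ^+ 2) / (s%:C - z) by field.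
rewrite (le_trans (normcD _ _))// lerD2l normcM ler_wpM2l ?normc_ge0//.
by rewrite normcV lef_pV2 ?posrE ?normc_gt0// Im_le_normc_real_subr.
Qed.

Variable mu : probability borelR R.
Hypothesis mu_rho : nevanlinna_measure mu rho.

Lemma F_difference z w : 0 < complex.Im z -> 0 < complex.Im w ->
  F_transform mu z - F_transform mu w =
  (z - w) * (1 + cintegral rho (nevanlinna_kernel z w)).
Proof.
move=> z0 w0; rewrite (mu_rho z0) (mu_rho w0).
rewrite mulrDr mulr1 -cintegralZ; last exact: cintegrable_kernel.
have -> : cintegral rho (fun s => (z - w) * nevanlinna_kernel z w s) =
   cintegral rho (fun s => (1 + s%:C * z) / (s%:C - z)) -
   cintegral rho (fun s => (1 + s%:C * w) / (s%:C - w)).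
  rewrite -cintegralB; [|exact: cintegrable_nevanlinna..].
  apply: eq_cintegral => s; rewrite /nevanlinna_kernel rmorphD rmorphXn rmorph1.
  by field; rewrite !real_subr_neq0.
ring.
Qed.

Lemma Im_F_nevanlinna z : 0 < complex.Im z ->
  complex.Im (F_transform mu z) = complex.Im z * (1 + poisson_mass z).
Proof.
move=> z0; rewrite (mu_rho z0) !Im_add /= add0r mulrDr mulr1; congr (_ + _).
rewrite -RintegralZl//; last exact: integrable_weighted_poisson.
apply: eq_Rintegral => s _; rewrite Im_mul Re_inv Im_inv /weighted_poisson !ReImE /=.
by ring.
Qed.

Definition subordination_inverse (p : R) z : C :=
  p%:C * z - (p - 1)%:C * F_transform mu z.

Lemma Im_subordination_inverse p z : 0 < complex.Im z ->
  complex.Im (subordination_inverse p z) =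
  complex.Im z * (1 - (p - 1) * poisson_mass z).
Proof.
move=> z0; rewrite /subordination_inverse Im_add Im_opp !Im_realM.
by rewrite Im_F_nevanlinna//; ring.
Qed.

(** If z and w have the same image, [F_difference] gives
    [(p - 1) * K = 1], where K is the integral of the kernel of z and w. By
    [Re_cintegral_kernel_le] the real part of K is at most the mean of the Poisson
    masses at z and w, and both are below [1 / (p - 1)] because the image is in
    the upper half-plane. *)
Lemma subordination_inverse_inj p z w : 1 < p -> 0 < complex.Im z -> 0 < complex.Im w ->
  0 < complex.Im (subordination_inverse p z) ->
  subordination_inverse p z = subordination_inverse p w -> z = w.
Proof.
move=> p1 z0 w0 Pz0 PzPw.
have Pw0 : 0 < complex.Im (subordination_inverse p w) by rewrite -PzPw.
rewrite Im_subordination_inverse// pmulr_rgt0// in Pz0.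
rewrite Im_subordination_inverse// pmulr_rgt0// in Pw0.
apply: contrapT => /eqP zw; rewrite -subr_eq0 in zw.
have Re1 : (p - 1) * complex.Re (cintegral rho (nevanlinna_kernel z w)) = 1.
  have : p%:C * (z - w) = (p - 1)%:C * (F_transform mu z - F_transform mu w).
    apply/eqP; rewrite !mulrBr -subr_eq0; apply/eqP.
    by move: PzPw; rewrite /subordination_inverse => /eqP; rewrite -subr_eq0 => /eqP <-; ring.
  rewrite F_difference// mulrCA mulrC => /(mulfI zw).
  move=> /(congr1 (@complex.Re R)); rewrite !ReImE /= !mul0r !subr0.
  by move=> h; lra.
have := Re_cintegral_kernel_le z0 w0.
by set k := complex.Re _ in Re1 *; set a := poisson_mass z in Pz0 *;
   set b := poisson_mass w in Pw0 *; move: Re1 Pz0 Pw0 p1; nra.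
Qed.

Lemma subordination_inverseK p nu z : 1 < p -> free_power p mu nu ->
  0 < complex.Im z -> subordination_inverse p (subordination p nu z) = z.
Proof.
move=> p1 fp z0; rewrite /subordination_inverse (F_subordination p1 fp z0).
have p0 : p%:C != 0 by rewrite eq_complex /= eqxx andbT gt_eqF// (lt_trans ltr01).
rewrite /subordination !rmorphB rmorph1 fmorphV.
by field.
Qed.

(** [subordination_inverse] is a left inverse of [subordination] everywhere,
    hence also a right inverse wherever it is injective. *)
Lemma subordinationK p nu z : 1 < p -> free_power p mu nu ->
  0 < complex.Im z -> 0 < complex.Im (subordination_inverse p z) ->
  subordination p nu (subordination_inverse p z) = z.
Proof.
move=> p1 fp z0 Pz0; apply/esym/(subordination_inverse_inj p1) => //.
  exact: Im_subordination_gt0.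
by rewrite subordination_inverseK.
Qed.

Lemma F_subordination_inverse p nu z : 1 < p -> free_power p mu nu ->
  0 < complex.Im z -> 0 < complex.Im (subordination_inverse p z) ->
  F_transform nu (subordination_inverse p z) = F_transform mu z.
Proof.
by move=> p1 fp z0 Pz0; rewrite -(F_subordination p1 fp Pz0) subordinationK.
Qed.

End Nevanlinna.

(** * Boundary behaviour: nontangential limits and the function f *)

Section BoundaryBehaviour.
Variable R : realType.
Local Notation C := R[i].
Local Notation borelR := (measurableTypeR R).
Implicit Types (z w : C) (x A : R) (u : nat -> C).

Definition stolz_sequence A x u : Prop :=
  (forall n, 0 < complex.Im (u n) /\ `|complex.Re (u n) - x| <= A * complex.Im (u n))
  /\ ctends u x%:C.

(** The sequential form of nontangential limits gives access to dominated
    convergence and to Fatou's lemma. *)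
Lemma nontangential_limitP (f : C -> C) x (l : C) :
  nontangential_limit f x l <->
  (forall A u, 0 < A -> stolz_sequence A x u -> ctends (fun n => f (u n)) l).
Proof.
split=> [fl A u A0 [uA ux]|fl A A0].
  split; apply: cvg_comp (fl A A0) => P [e /= e0 eP].
  have [u_x] := ux; have /(@cvgrPdist_lt C C^o) /(_ _ e0) := u_x.
  apply: filterS => n un; apply: eP; first exact: un.
  exact: uA.
apply/(@cvgrPdist_lt C C^o) => e e0; apply: contrapT => nP.
have bad n : exists z : C, [/\ 0 < complex.Im z,
    `|complex.Re z - x| <= A * complex.Im z,
    normc (z - x%:C) < n.+1%:R^-1 & ~ `|l - f z| < e].
  apply: contrapT => nz; apply: nP.
  exists (n.+1%:R^-1)%:C => /=; first by rewrite ltcR invr_gt0.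
  move=> z /= zx [z0 zA]; apply: contrapT => le; apply: nz; exists z; split=> //.
  by move: zx; rewrite /ball_ distrC normr_normc ltcR.
have [u uP] := choice bad.
have uS : stolz_sequence A x u.
  split=> [n|]; first by have [] := uP n.
  apply: (@ctends_squeeze _ _ _ (@harmonic R)); last exact: cvg_harmonic.
  by near=> n; have [_ _ h _] := uP n; exact: ltW.
have [fu] := fl A u A0 uS.
have /(@cvgrPdist_lt C C^o) /(_ _ e0) [N _ NP] := fu.
have [_ _ _ h] := uP N; apply: h; exact: NP (leqnn N).
Unshelve. all: by end_near. Qed.

Definition vertical_sequence x (n : nat) : C := x +i* n.+1%:R^-1.

Lemma vertical_stolz x : stolz_sequence 1 x (vertical_sequence x).
Proof.
split=> [n|]; first by rewrite /= subrr normr0 mul1r invr_gt0 invr_ge0; split.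
apply: ctends_ReIm => /=; first exact: cvg_cst.
exact: cvg_harmonic.
Qed.

Lemma nontangential_limit_unique (f : C -> C) x (l l' : C) :
  nontangential_limit f x l -> nontangential_limit f x l' -> l = l'.
Proof.
move=> /nontangential_limitP fl /nontangential_limitP fl'.
apply: (@ctends_unique R (fun n => f (vertical_sequence x n))).
  exact: fl ltr01 (vertical_stolz x).
exact: fl' ltr01 (vertical_stolz x).
Qed.

(** If the quotient of [u n - y] by a purely imaginary quantity tends to a
    positive real number, then u leaves y in the vertical direction. This applies
    to the images of vertical sequences under the subordination function and its
    inverse. *)
Lemma vertical_image_stolz x y (d : R) u : 0 < d ->
  ctends (fun n => (u n - y%:C) / (vertical_sequence x n - x%:C)) d%:C ->
  exists N, stolz_sequence 1 y (fun n => u (n + N)%N).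
Proof.
move=> d0 ud.
have t0 n : 0 < n.+1%:R^-1 :> R by rewrite invr_gt0.
have vE n : vertical_sequence x n - x%:C = 0 +i* n.+1%:R^-1.
  by apply: complex_eqP; rewrite !ReImE /= ?subrr ?subr0.
have v0 n : vertical_sequence x n - x%:C != 0.
  by rewrite vE eq_complex negb_and /= (gt_eqF (t0 n)) orbT.
set q := (fun n => _) in ud.
have uE n : u n = y%:C + q n * (0 +i* n.+1%:R^-1).
  by rewrite /q -vE mulfVK// addrC subrK.
clearbody q; have d4 : 0 < d / 4 by rewrite divr_gt0.
have /cvgrPdist_lt /(_ _ d4) [N1 _ N1P] := ctends_Re ud.
have /cvgrPdist_lt /(_ _ d4) [N2 _ N2P] := ctends_Im ud.
exists (maxn N1 N2); split.
  move=> k; set n := (k + _)%N.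
  have nle : (maxn N1 N2 <= n)%N by rewrite leq_addl.
  move: nle; rewrite geq_max => /andP[/N1P h1 /N2P h2]; rewrite /= sub0r normrN in h2.
  rewrite /= in h1; have := le_lt_trans (ler_norm _) h1 => h3.
  rewrite uE !ReImE /= !mulr0 sub0r add0r addr0.
  have q1 : d / 2 < complex.Re (q n) by move: h3; lra.
  have tn := t0 n; split; first by rewrite mulr_gt0// (lt_trans _ q1)// divr_gt0.
  rewrite addrC addKr normrN normrM (gtr0_norm tn) mul1r ler_wpM2r ?(ltW tn)//.
  by move: h2 q1 d0; lra.
apply: (@ctends_shift R u).
have := ctendsD (ctends_cst y%:C) (ctendsM ud (vertical_stolz 0).2).
rewrite mulr0 addr0; apply: eq_ctends => n; rewrite uE; congr (_ + _ * _).
Qed.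

Section FunctionF.
Variable rho : {finite_measure set borelR -> \bar R}.

Definition f_integrand x (s : borelR) : \bar R :=
  (if s == x then +oo else ((s ^+ 2 + 1) / (s - x) ^+ 2)%:E)%E.

Lemma f_integrand_ge0 x s : (0 <= f_integrand x s)%E.
Proof.
rewrite /f_integrand; case: eqP => // _.
by rewrite lee_fin divr_ge0 ?sqr_ge0// addr_ge0 ?sqr_ge0.
Qed.

Lemma f_functionE x : f_function rho x = (\int[rho]_(s in setT) f_integrand x s)%E.
Proof. by []. Qed.

Lemma f_function_ge0 x : (0 <= f_function rho x)%E.
Proof. by apply: integral_ge0 => s _; exact: f_integrand_ge0. Qed.

Lemma weighted_poisson_cvg u x s : ctends u x%:C -> s != x ->
  (fun n => weighted_poisson (u n) s) @ \oo --> (s ^+ 2 + 1) / (s - x) ^+ 2.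
Proof.
move=> ux sx; have sx0 : s - x != 0 by rewrite subr_eq0.
apply: cvgM; first exact: cvg_cst.
apply: cvgV; first by rewrite expf_neq0.
have -> : (s - x) ^+ 2 = (s - x) ^+ 2 + 0 ^+ 2 by rewrite expr0n /= addr0.
under eq_fun do rewrite normc_sqr !ReImE /= sub0r.
apply: cvgD.
  have h : (fun n => s - complex.Re (u n)) @ \oo --> s - x.
    by apply: cvgB; [exact: cvg_cst|exact: (ctends_Re ux)].
  exact: (cvgM h h).
have h : (fun n => - complex.Im (u n)) @ \oo --> (0 : R).
  by rewrite -oppr0; apply: cvgN; exact: (ctends_Im ux).
exact: (cvgM h h).
Qed.

Lemma weighted_poisson_diverges u x : ctends u x%:C -> (forall n, 0 < complex.Im (u n)) ->
  (fun n => (weighted_poisson (u n) x)%:E) @ \oo --> +oo%E.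
Proof.
move=> ux u0; apply/cvgeryP/cvgryPge => B.
have B1 : 0 < (`|B| + 1)^-1 by rewrite invr_gt0 ltr_pwDr.
have e0 : 0 < Num.min 1 (`|B| + 1)^-1 by rewrite lt_min ltr01.
have /ctendsP /cvgrPdist_lt /(_ _ e0) := ux; apply: filterS => n.
rewrite sub0r normrN ger0_norm ?normc_ge0// lt_min => /andP[n1 nB].
have nu : 0 < normc (x%:C - u n) by rewrite normc_gt0 real_subr_neq0.
rewrite normc_distC in n1 nB.
rewrite /weighted_poisson ler_pdivlMr ?exprn_gt0//.
have : normc (x%:C - u n) * (`|B| + 1) < 1.
  by rewrite -ltr_pdivlMr ?ltr_pwDr// div1r.
have := ler_norm B; have := normr_ge0 B; have := sqr_ge0 x.
set t := normc _ in nu n1 nB *; set b := `|B| => x2 b0 Bb tb.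
have t2 : t ^+ 2 <= t by rewrite expr2 ger_pMr ?ltW.
have : B * t ^+ 2 <= b * t.
  by apply: (@le_trans _ _ (b * t ^+ 2)); [rewrite ler_wpM2r ?sqr_ge0|rewrite ler_wpM2l].
by move: tb x2 nu; rewrite mulrDr mulr1 [t * b]mulrC; lra.
Qed.

(** At [s = x] the limit is infinite, which is the value given to the integrand
    there. *)
Lemma f_integrand_cvg u x s : ctends u x%:C -> (forall n, 0 < complex.Im (u n)) ->
  (fun n => (weighted_poisson (u n) s)%:E) @ \oo --> f_integrand x s.
Proof.
move=> ux u0; rewrite /f_integrand; case: eqP => [->|/eqP sx].
  exact: weighted_poisson_diverges.
by apply: cvg_EFin; [near=> n|exact: weighted_poisson_cvg].
Unshelve. all: by end_near. Qed.

Lemma measurable_f_integrand x : measurable_fun [set: borelR] (f_integrand x).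
Proof.
apply: (@emeasurable_fun_cvg _ _ _ setT
   (fun n s => (weighted_poisson (vertical_sequence x n) s)%:E)).
  by move=> n; apply/measurable_EFinP; exact: measurable_weighted_poisson.
move=> s _; apply: f_integrand_cvg; first exact: (vertical_stolz x).2.
by move=> n; exact: ((vertical_stolz x).1 n).1.
Qed.

Lemma poisson_mass_EFin z : 0 < complex.Im z ->
  (poisson_mass rho z)%:E = (\int[rho]_(s in setT) (weighted_poisson z s)%:E)%E.
Proof.
move=> z0; rewrite /poisson_mass /Rintegral fineK//.
exact: integrable_fin_num (integrable_weighted_poisson rho z0).
Qed.

(** Fatou's lemma applied to the Poisson kernels. *)
Lemma f_function_le_lim u x (L : R) : ctends u x%:C ->
  (forall n, 0 < complex.Im (u n)) ->
  (fun n => poisson_mass rho (u n)) @ \oo --> L -> (f_function rho x <= L%:E)%E.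
Proof.
move=> ux u0 uL.
rewrite f_functionE (eq_integral (fun s => limn_einf
   (fun n => (weighted_poisson (u n) s)%:E))); last first.
  move=> s _; have h := f_integrand_cvg (s := s) ux u0.
  by rewrite is_cvg_limn_einfE; [apply/esym/cvg_lim|apply/cvg_ex; eexists; exact: h].
apply: (le_trans (@fatou _ _ _ rho setT measurableT
   (fun n s => (weighted_poisson (u n) s)%:E) _ _)).
- by move=> n; apply/measurable_EFinP; exact: measurable_weighted_poisson.
- by move=> n s _; rewrite lee_fin weighted_poisson_ge0.
have h : (fun n => \int[rho]_(s in setT) (weighted_poisson (u n) s)%:E)%E @ \oo --> L%:E.
  under eq_fun do rewrite -poisson_mass_EFin//.
  by apply: cvg_EFin => //; near=> n.
by rewrite is_cvg_limn_einfE; [rewrite (cvg_lim _ h)|apply/cvg_ex; eexists; exact: h].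
Unshelve. all: by end_near. Qed.

Lemma poisson_mass_le z x (M : R) : 0 < complex.Im z -> complex.Re z = x ->
  f_function rho x = M%:E -> poisson_mass rho z <= M.
Proof.
move=> z0 zx fM; rewrite -lee_fin -fM poisson_mass_EFin// f_functionE.
apply: ge0_le_integral => //.
- by move=> s _; rewrite lee_fin weighted_poisson_ge0.
- by apply/measurable_EFinP; exact: measurable_weighted_poisson.
- exact: measurable_f_integrand.
move=> s _; rewrite /f_integrand; case: eqP => [_|/eqP sx]; first exact: leey.
have sx0 : s - x != 0 by rewrite subr_eq0.
have sx2 : 0 < (s - x) ^+ 2 by rewrite exprn_even_gt0.
rewrite lee_fin ler_wpM2l ?addr_ge0 ?sqr_ge0// lef_pV2 ?posrE//.
  by rewrite normc_sqr !ReImE /= zx lerDl sqr_ge0.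
by rewrite normc_sqr !ReImE /= zx ltr_pwDl// sqr_ge0.
Qed.

Section Finite.
Variables (x M : R).
Hypothesis fM : f_function rho x = M%:E.

Lemma integrable_f_integrand : rho.-integrable [set: borelR] (f_integrand x).
Proof.
apply/integrableP; split; first exact: measurable_f_integrand.
under eq_integral do rewrite gee0_abs ?f_integrand_ge0//.
by rewrite -f_functionE fM ltry.
Qed.

Lemma f_finite_ae : {ae rho, forall s : borelR, s != x}.
Proof.
have := integrable_ae measurableT integrable_f_integrand.
by apply: filterS => s /(_ I); rewrite /f_integrand; case: eqP.
Qed.

(** In a cone at x the distance from s to x is at most [A + 2] times the
    distance from s to z. *)
Lemma stolz_weighted_poisson_le A z s : 0 < complex.Im z ->
  `|complex.Re z - x| <= A * complex.Im z -> s != x ->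
  ((weighted_poisson z s)%:E <= ((A + 2) ^+ 2)%:E * f_integrand x s)%E.
Proof.
move=> z0 zA sx; rewrite /f_integrand (negbTE sx) -EFinM lee_fin /weighted_poisson.
have sx0 : s - x != 0 by rewrite subr_eq0.
have sx2 : 0 < (s - x) ^+ 2 by rewrite exprn_even_gt0.
have nu : 0 < normc (s%:C - z) by rewrite normc_gt0 real_subr_neq0.
rewrite mulrCA ler_wpM2l ?addr_ge0 ?sqr_ge0//.
rewrite ler_pdivlMr// mulrC ler_pdivrMr ?exprn_gt0// -exprMn.
have A0 : 0 <= A by have := le_trans (normr_ge0 _) zA; rewrite pmulr_lge0.
rewrite -(real_normK (num_real (s - x))) lerXn2r ?nnegrE ?mulr_ge0 ?normc_ge0 ?addr_ge0//.
have -> : s - x = complex.Re (s%:C - z) + (complex.Re z - x) by rewrite !ReImE /=; ring.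
have := Im_le_normc_real_subr z s; have := normr_Re_le (s%:C - z).
have := ler_normD (complex.Re (s%:C - z)) (complex.Re z - x).
set t := normc _ in nu *; set y := complex.Im z in z0 zA *.
move: zA A0; set a := `|_ + _|; set b := `|complex.Re (s%:C - z)|; set c := `|_|.
by nra.
Qed.

Lemma f_finite_kernel_sqr s : s != x ->
  ((weighted_poisson x%:C s)%:E = f_integrand x s)%E.
Proof.
move=> sx; rewrite /f_integrand (negbTE sx) /weighted_poisson normc_sqr !ReImE /=.
by rewrite subrr expr0n /= addr0.
Qed.

Lemma ctends_kernel w u s : ctends u x%:C -> s != x ->
  ctends (fun n => nevanlinna_kernel w (u n) s) (nevanlinna_kernel w x%:C s).
Proof.
move=> ux sx; apply: ctendsZ; apply: ctendsZ; apply: ctendsV.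
  by rewrite -rmorphB /= eq_complex /= eqxx andbT subr_eq0.
by apply: ctendsB => //; exact: ctends_cst.
Qed.

Lemma integrable_f_integrandZ (k : R) :
  rho.-integrable [set: borelR] (fun s => k%:E * f_integrand x s)%E.
Proof. by apply: integrableZl => //; exact: integrable_f_integrand. Qed.

(** The kernel at w and u n is dominated by the two Poisson kernels, and the
    second one by a multiple of the integrand of f at x. Since that integrand is
    integrable, the point x is a null set of rho. *)
Lemma kernel_upper_cvg A u w : 0 < complex.Im w -> stolz_sequence A x u ->
  ctends (fun n => cintegral rho (nevanlinna_kernel w (u n)))
         (cintegral rho (nevanlinna_kernel w x%:C)).
Proof.
move=> w0 [uA ux].
have ig : rho.-integrable [set: borelR] (fun s => (weighted_poisson w s)%:E +
    ((A + 2) ^+ 2)%:E * f_integrand x s)%E.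
  apply: integrableD => //; first exact: integrable_weighted_poisson.
  exact: integrable_f_integrandZ.
have [||||_] := @cintegral_dominated R rho (fun n => nevanlinna_kernel w (u n))
  (nevanlinna_kernel w x%:C) _ 0 _ _ ig => //.
- by move=> n; exact: cmeasurable_kernel.
- exact: cmeasurable_kernel.
- by apply: filterS f_finite_ae => s sx; exact: ctends_kernel.
apply: filterS f_finite_ae => s sx n _; have [un0 unA] := uA n.
apply: (@le_trans _ _ ((weighted_poisson w s)%:E + (weighted_poisson (u n) s)%:E)%E).
  rewrite -EFinD lee_fin (le_trans (normc_kernel_le _ _ _))//.
  have := weighted_poisson_ge0 w s; have := weighted_poisson_ge0 (u n) s; lra.
by rewrite leeD2l// stolz_weighted_poisson_le.
Qed.

Lemma kernel_boundary_cvg A u : stolz_sequence A x u ->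
  ctends (fun n => cintegral rho (nevanlinna_kernel (u n) x%:C)) M%:C.
Proof.
move=> [uA ux].
have ig := integrable_f_integrandZ ((A + 2) ^+ 2 + 1).
have [||||] := @cintegral_dominated R rho (fun n => nevanlinna_kernel (u n) x%:C)
  (nevanlinna_kernel x%:C x%:C) _ 0 _ _ ig => //.
- by move=> n; exact: cmeasurable_kernel.
- exact: cmeasurable_kernel.
- apply: filterS f_finite_ae => s sx.
  apply: eq_ctends (ctends_kernel x%:C ux sx) => n.
  by rewrite /nevanlinna_kernel [_^-1 * _]mulrC.
- apply: filterS f_finite_ae => s sx n _; have [un0 unA] := uA n.
  apply: (@le_trans _ _ ((weighted_poisson (u n) s)%:E + (weighted_poisson x%:C s)%:E)%E).
    rewrite -EFinD lee_fin (le_trans (normc_kernel_le _ _ _))//.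
    have := weighted_poisson_ge0 x%:C s; have := weighted_poisson_ge0 (u n) s; lra.
  rewrite EFinD ge0_muleDl ?lee_fin ?sqr_ge0// mul1e.
  by rewrite leeD ?stolz_weighted_poisson_le// f_finite_kernel_sqr.
have -> : cintegral rho (nevanlinna_kernel x%:C x%:C) = M%:C; last by [].
have kE s : s != x -> nevanlinna_kernel x%:C x%:C s = (weighted_poisson x%:C s)%:C.
  move=> sx; have sx0 : s - x != 0 by rewrite subr_eq0.
  rewrite /nevanlinna_kernel -!rmorphB -!fmorphV -!rmorphM; congr (_%:C).
  rewrite /weighted_poisson normc_sqr !ReImE /= subrr expr0n /= addr0.
  by rewrite -invfM.
have kR s : complex.Im (nevanlinna_kernel x%:C x%:C s) = 0.
  by rewrite /nevanlinna_kernel -!rmorphB -!fmorphV -!rmorphM.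
apply: complex_eqP; last first.
  transitivity (\int[rho]_(s in setT) (0 : R)); last by rewrite Rintegral_cst// mul0r.
  by apply: eq_Rintegral => s _; exact: kR.
rewrite -[LHS]/(fine _) -[RHS]/(fine M%:E) -fM f_functionE; congr fine.
apply: ae_eq_integral => //.
- by apply/measurable_EFinP; have [] := cmeasurable_kernel x%:C x%:C.
- exact: measurable_f_integrand.
apply: filterS f_finite_ae => s sx _.
by rewrite kE//= f_finite_kernel_sqr.
Qed.

Variable mu : probability borelR R.
Hypothesis mu_rho : nevanlinna_measure mu rho.

(** When f is finite at x, the formula of [F_difference] passes to the limit,
    first in one of its two points, which gives the boundary value c, then in the
    other, which gives the derivative. The limit c is computed from an arbitrary
    base point, here the imaginary unit; it does not depend on it because limits
    are unique. *)
Lemma julia_caratheodory : exists c : C, forall A u, stolz_sequence A x u ->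
  ctends (fun n => F_transform mu (u n)) c /\
  ctends (fun n => (F_transform mu (u n) - c) / (u n - x%:C)) (1 + M)%:C.
Proof.
have i0 : 0 < complex.Im (0 +i* 1 : C) by rewrite /= ltr01.
pose lim w := F_transform mu w + (x%:C - w) *
   (1 + cintegral rho (nevanlinna_kernel w x%:C)).
have limP A u w : 0 < complex.Im w -> stolz_sequence A x u ->
    ctends (fun n => F_transform mu (u n)) (lim w).
  move=> w0 uS; have [uA ux] := uS; have := kernel_upper_cvg w0 uS => kc.
  have := ctendsD (ctends_cst (F_transform mu w)) (ctendsM
    (ctendsB ux (ctends_cst w)) (ctendsD (ctends_cst 1) kc)).
  apply: eq_ctends => n; have [un0 _] := uA n.
  have := F_difference mu_rho w0 un0; rewrite -opprB => E.
  by rewrite -(opprB w) mulNr -E opprB addrC -opprB opprK subrK.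
exists (lim (0 +i* 1)) => A u uS; split; first exact: limP i0 uS.
have [uA ux] := uS.
have := ctendsD (ctends_cst 1) (kernel_boundary_cvg uS).
rewrite -(rmorph1 (real_complex R)) -rmorphD; apply: eq_ctends => n.
have [un0 _] := uA n.
have -> : lim (0 +i* 1) = lim (u n).
  apply: (ctends_unique (limP _ _ _ i0 (vertical_stolz x))).
  exact: limP un0 (vertical_stolz x).
have ux0 := subr_real_neq0 x un0.
rewrite /lim opprD addrA subrr add0r -mulNr opprB mulrAC divff// mul1r.
by rewrite rmorph1.
Qed.

End Finite.
End FunctionF.
End BoundaryBehaviour.

(** * Atoms of Boolean powers and boundary values of free powers *)

Section Atoms.
Variable R : realType.
Local Notation C := R[i].
Local Notation borelR := (measurableTypeR R).
Implicit Types (mu nu lam : probability borelR R) (z w : C) (u : nat -> C).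

Lemma measurable_point (a : R) : measurable ([set a] : set borelR).
Proof. exact: measurable_set1. Qed.

Lemma atom_mass lam (a : R) : (lam [set a] = (fine (lam [set a]))%:E)%E.
Proof. by rewrite fineK// fin_num_measure//; exact: measurable_point. Qed.

(** The integrand [(u n - a) / (u n - s)] is bounded by [A + 1] in a cone and
    tends to the indicator of a. *)
Lemma cauchy_atom lam (a A : R) u : stolz_sequence A a u ->
  ctends (fun n => (u n - a%:C) * cauchy_transform lam (u n))
         (fine (lam [set a]))%:C.
Proof.
move=> [uA ua].
pose f n (s : borelR) := (u n - a%:C) * (u n - s%:C)^-1.
have mind : measurable_fun [set: borelR] (\1_[set a] : borelR -> R).
  by apply: measurable_indic; exact: measurable_point.
have [|||||_] := @cintegral_dominated R lam f (fun s => (\1_[set a] s)%:C)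
  (fun=> (A + 1)%:E) 0.
- by move=> n; apply: cmeasurableM; [exact: cmeasurable_cst|exact: cmeasurable_resolvent].
- exact: cmeasurable_real.
- exact: integrable_prob_cst.
- apply: aeW => s; rewrite indicE; have [->|sa] := eqVneq s a.
    rewrite mem_set//=; apply: eq_ctends (ctends_cst _) => n.
    by rewrite /f mulfV// subr_real_neq0//; exact: (uA n).1.
  rewrite memNset /=; last by move=> /= sE; move: sa; rewrite sE eqxx.
  have as0 : a%:C - s%:C != 0 by rewrite -rmorphB eq_complex /= eqxx andbT subr_eq0 eq_sym.
  have := ctendsM (ctendsB ua (ctends_cst a%:C))
    (ctendsV as0 (ctendsB ua (ctends_cst s%:C))).
  by rewrite subrr mul0r.
- apply: aeW => s n _; have [un0 unA] := uA n; rewrite lee_fin normcM normcV.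
  rewrite ler_pdivrMr ?normc_gt0 ?subr_real_neq0//.
  have A0 : 0 <= A by have := le_trans (normr_ge0 _) unA; rewrite pmulr_lge0.
  apply: (@le_trans _ _ ((A + 1) * complex.Im (u n))).
    rewrite (le_trans (normc_le_ReIm _))// !ReImE /= subr0 (gtr0_norm un0).
    by rewrite mulrDl mul1r lerD2r.
  by rewrite ler_wpM2l ?addr_ge0// Im_le_normc_subr.
rewrite (_ : cintegral _ _ = (fine (lam [set a]))%:C).
  apply: eq_ctends => n; rewrite cintegralZ//.
  by apply: cintegrable_resolvent; exact: (uA n).1.
apply: complex_eqP; last first.
  exact: Rintegral_prob_cst.
rewrite -[LHS]/(fine _) -[RHS]/(fine _); congr fine.
rewrite integral_indic//.
by rewrite setIT.
Qed.

Lemma is_point_mass_atom lam (a : R) : fine (lam [set a]) = 1 -> is_point_mass lam.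
Proof.
move=> la1; have la : lam [set a] = 1%E by rewrite atom_mass la1.
exists a => A mA; rewrite diracE; have ma := measurable_point a.
have [aA|aA] := boolP (a \in A).
  apply/eqP; rewrite eq_le; apply/andP; split.
    exact: probability_le1.
  rewrite -[leLHS]la; apply: le_measure; rewrite ?inE//.
  by move=> s /= ->; exact: set_mem.
apply/eqP; rewrite eq_le measure_ge0 andbT.
apply: (@le_trans _ _ (lam (~` [set a]))); last by rewrite probability_setC// la subee.
apply: le_measure; rewrite ?inE//; first exact: measurableC.
by move=> s As /= sa; move: aA; rewrite -sa mem_set.
Qed.

Lemma ctends_of_quotient (f u : nat -> C) (c d : C) (a : R) :
  (forall n, 0 < complex.Im (u n)) -> ctends u a%:C ->
  ctends (fun n => (f n - c) / (u n - a%:C)) d -> ctends f c.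
Proof.
move=> u0 ua fd.
have := ctendsD (ctendsM fd (ctendsB ua (ctends_cst a%:C))) (ctends_cst c).
rewrite subrr mulr0 add0r; apply: eq_ctends => n.
by rewrite mulfVK ?subrK// subr_real_neq0.
Qed.

Lemma quotient_quotient (a b e : C) : b != 0 -> (a / b) / (e / b) = a / e.
Proof. by move=> b0; rewrite invfM invrK mulrA [_ * b]mulrC mulrA mulrCA mulfV// mulr1. Qed.

Lemma real_complex_neq0 (k : R) : (k%:C != 0 :> C) = (k != 0).
Proof. by rewrite eq_complex /= eqxx andbT. Qed.

Section BooleanPower.
Variables (q : R) (nu lam : probability borelR R).
Hypothesis q0 : 0 < q.
Hypothesis nu_lam : boolean_power q nu lam.
Variables (a : R).
Let c : C := (a * (1 - q^-1))%:C.

(** The definition of the Boolean power, centred at the value c that makes the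
    constant terms cancel. *)
Lemma F_boolean_power z : 0 < complex.Im z ->
  F_transform lam z = q%:C * (F_transform nu z - c) + (1 - q)%:C * (z - a%:C).
Proof.
move=> z0; have := nu_lam z0; rewrite /E_transform => E.
have -> : F_transform lam z = z - (z - F_transform lam z) by rewrite opprB addrC subrK.
have qc : q%:C != 0 :> C by rewrite real_complex_neq0 gt_eqF.
rewrite E /c rmorphM !rmorphB rmorph1 fmorphV.
by field.
Qed.

(** By [cauchy_atom], [F_transform lam] vanishes at an atom of mass m with
    derivative [m^-1]; [F_boolean_power] transfers this to [nu]. *)
Lemma atom_free_power : 0 < fine (lam [set a]) ->
  nontangential_limit (F_transform nu) a c /\
  JC_derivative (F_transform nu) a (1 + ((fine (lam [set a]))^-1 - 1) / q)%:C.
Proof.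
set m := fine _ => m0.
have quot A u : stolz_sequence A a u ->
    ctends (fun n => (F_transform nu (u n) - c) / (u n - a%:C))
      (1 + (m^-1 - 1) / q)%:C.
  move=> uS; have [uA ua] := uS.
  have mC : m%:C != 0 :> C by rewrite real_complex_neq0 gt_eqF.
  have := ctendsZ (q^-1)%:C (ctendsB (ctendsV mC (cauchy_atom lam uS))
    (ctends_cst (1 - q)%:C)).
  have qC : q%:C != 0 :> C by rewrite real_complex_neq0 gt_eqF.
  have -> : (q^-1)%:C * (m%:C^-1 - (1 - q)%:C) = (1 + (m^-1 - 1) / q)%:C.
    rewrite -fmorphV -rmorphB -rmorphM; congr (_%:C).
    by field; rewrite !gt_eqF.
  apply: eq_ctends => n; have un0 := (uA n).1; have una := subr_real_neq0 a un0.
  rewrite invfM -/(F_transform lam (u n)) F_boolean_power// fmorphV.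
  by field; rewrite una.
have lim : nontangential_limit (F_transform nu) a c.
  apply/nontangential_limitP => A u A0 uS; have [uA ua] := uS.
  exact: ctends_of_quotient (fun n => (uA n).1) ua (quot A u uS).
split; [exact: lim|exists c; first exact: lim].
by apply/nontangential_limitP => A u A0; exact: quot.
Qed.

(** Only one nontangential sequence is required, since [cauchy_atom] already
    provides the nontangential limit. *)
Lemma atom_of_free_power A u (d : R) : stolz_sequence A a u ->
  ctends (fun n => (F_transform nu (u n) - c) / (u n - a%:C)) d%:C ->
  0 < 1 + q * (d - 1) -> fine (lam [set a]) = (1 + q * (d - 1))^-1.
Proof.
move=> uS quot L0; have [uA ua] := uS.
have LC : (1 + q * (d - 1))%:C != 0 :> C by rewrite real_complex_neq0 gt_eqF.
have := ctendsV LC (_ : ctends (fun n => F_transform lam (u n) / (u n - a%:C)) _).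
have h : ctends (fun n => F_transform lam (u n) / (u n - a%:C)) (1 + q * (d - 1))%:C.
  have := ctendsD (ctendsZ q%:C quot) (ctends_cst (1 - q)%:C).
  have -> : q%:C * d%:C + (1 - q)%:C = (1 + q * (d - 1))%:C.
    by rewrite -rmorphM -rmorphD; congr (_%:C); ring.
  apply: eq_ctends => n; have un0 := (uA n).1; have una := subr_real_neq0 a un0.
  by rewrite F_boolean_power// [RHS]mulrDl mulfK// mulrA.
move=> /(_ h) lim; apply: (@complexI R).
rewrite fmorphV; apply: (ctends_unique (cauchy_atom lam uS)).
by apply: eq_ctends lim => n; rewrite invfM /F_transform !invrK mulrC.
Qed.

End BooleanPower.

Section FreePower.
Variables (mu : probability borelR R) (rho : {finite_measure set borelR -> \bar R}).
Hypothesis mu_rho : nevanlinna_measure mu rho.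

(** The integrand of f is positive, so rho is zero and [F_transform mu] is a
    translation. *)
Lemma f_function_zero_point_mass (x : R) : f_function rho x = 0%E -> is_point_mass mu.
Proof.
move=> f0.
have rho0 : rho setT = 0%E.
  have mf := measurable_f_integrand x.
  have : (\int[rho]_(s in setT) `|f_integrand x s| = 0)%E.
    by under eq_integral do rewrite gee0_abs ?f_integrand_ge0//.
  move=> /(ae_eq_integral_abs rho measurableT mf) [A [mA A0 subA]].
  apply/eqP; rewrite eq_le measure_ge0 andbT -[leRHS]A0.
  apply: le_measure; rewrite ?inE//.
  move=> s _; apply: subA => /(_ I) /= /eqP; rewrite /f_integrand; case: (eqVneq s x) => // sx.
  rewrite eqe mulf_eq0 invr_eq0 expf_eq0 /= subr_eq0 (negbTE sx) orbF.
  by rewrite gt_eqF// ltr_wpDl// sqr_ge0.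
have int0 (k : R) : \int[rho]_(s in setT) k = 0.
  rewrite Rintegral_cst// -[RHS](mulr0 k); congr (_ * _).
  by rewrite -[RHS]/(fine 0%E); congr fine; exact: rho0.
have k0 z w : 0 < complex.Im z -> 0 < complex.Im w ->
    cintegral rho (nevanlinna_kernel z w) = 0.
  move=> z0 w0; apply/eqP; rewrite -normc_eq0 eq_le normc_ge0 andbT.
  have := @normc_cintegral_le R rho (nevanlinna_kernel z w)
    (fun=> 2^-1 * (poisson_bound z + poisson_bound w)) (cintegrable_kernel rho z0 w0).
  rewrite int0 mulr0; apply.
    exact: (@integrable_bounded _ _ _ `|2^-1 * (poisson_bound z + poisson_bound w)|).
  move=> s; apply: le_trans (normc_kernel_le _ _ _) _.
  by rewrite ler_wpM2l ?invr_ge0// lerD ?weighted_poisson_le.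
have i0 : 0 < complex.Im (0 +i* 1 : C) by rewrite /= ltr01.
pose b := (0 +i* 1 : C) - F_transform mu (0 +i* 1).
have FE z : 0 < complex.Im z -> F_transform mu z = z - b.
  move=> z0; have := F_difference mu_rho z0 i0; rewrite k0// addr0 mulr1 => E.
  by rewrite -[LHS](subrK (F_transform mu (0 +i* 1))) E /b; ring.
have bR : b = (complex.Re b)%:C.
  apply: complex_eqP => //; rewrite {1}/b Im_add Im_opp (Im_F_nevanlinna mu_rho)//.
  rewrite /poisson_mass (_ : Rintegral _ _ _ = 0) ?addr0 ?mulr1 ?subrr//.
  have := @le_normr_Rintegral _ _ _ rho setT (weighted_poisson (0 +i* 1)) measurableT
    (integrable_weighted_poisson rho i0).
  move=> h; apply/eqP; rewrite -normr_le0 (le_trans h)//.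
  have ic : rho.-integrable [set: borelR] (EFin \o (fun=> poisson_bound (0 +i* 1 : C))).
    exact: (@integrable_bounded _ _ _ `|poisson_bound (0 +i* 1 : C)|).
  have := @le_Rintegral _ _ _ rho setT (fun s => `|weighted_poisson (0 +i* 1 : C) s|) _
    measurableT (integrable_norm (integrable_weighted_poisson rho i0)) ic.
  rewrite int0; apply => s _.
  by rewrite ger0_norm ?weighted_poisson_ge0// weighted_poisson_le.
apply: (@is_point_mass_atom _ (complex.Re b)); apply: (@complexI R).
apply: (ctends_unique (cauchy_atom mu (vertical_stolz (complex.Re b)))).
rewrite rmorph1; apply: eq_ctends (ctends_cst 1) => n.
have vn0 := ((vertical_stolz (complex.Re b)).1 n).1.
rewrite -bR -FE// /F_transform mulVf//.
exact: cauchy_neq0.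
Qed.

Lemma JC_of_f_function (x M : R) (c : C) : f_function rho x = M%:E ->
  nontangential_limit (F_transform mu) x c ->
  JC_derivative (F_transform mu) x (1 + M)%:C.
Proof.
move=> fM Fc; have [c' c'P] := julia_caratheodory fM mu_rho.
have Fc' : nontangential_limit (F_transform mu) x c'.
  by apply/nontangential_limitP => A u A0 uS; exact: (c'P A u uS).1.
exists c'; first exact: Fc'.
by apply/nontangential_limitP => A u A0 uS; exact: (c'P A u uS).2.
Qed.

(** The Julia-Caratheodory theorem from a single sequence. The difference
    quotients determine the limit of the Poisson masses, so Fatou's lemma makes f
    finite at x; then [julia_caratheodory] gives all the limits, and uniqueness
    identifies them along the sequence. *)
Lemma f_function_of_sequence A u (x c d : R) : stolz_sequence A x u ->
  ctends (fun n => (F_transform mu (u n) - c%:C) / (u n - x%:C)) d%:C ->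
  f_function rho x = (d - 1)%:E /\ nontangential_limit (F_transform mu) x c%:C.
Proof.
move=> uS quot; have [uA ux] := uS.
have Flim := ctends_of_quotient (fun n => (uA n).1) ux quot.
have pl : (fun n => poisson_mass rho (u n)) @ \oo --> d - 1.
  set k := (fun n => _) in quot.
  have kE n : F_transform mu (u n) = c%:C + k n * (u n - x%:C).
    by rewrite /k mulfVK ?subr_real_neq0 ?(uA n).1// addrC subrK.
  clearbody k.
  have pE n : poisson_mass rho (u n) = complex.Re (k n) - 1 +
      complex.Im (k n) * ((complex.Re (u n) - x) / complex.Im (u n)).
    have un0 := (uA n).1; have := Im_F_nevanlinna mu_rho un0.
    rewrite kE !ReImE /= subr0 add0r => E; apply: (mulfI (lt0r_neq0 un0)).
    rewrite mulrDr [X in _ + X]mulrCA [complex.Im (u n) * (_ / _)]mulrCA divff ?gt_eqF//.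
    by rewrite mulr1; move: E; lra.
  under eq_fun do rewrite pE.
  rewrite -[d - 1]addr0; apply: cvgD.
    by apply: cvgB; [exact: (ctends_Re quot)|exact: cvg_cst].
  have A0 : 0 <= A.
    by have [un0 /(le_trans (normr_ge0 _))] := uA 0%N; rewrite pmulr_lge0.
  apply/cvgr0Pnorm_le => e e0.
  have /cvgr0Pnorm_le /(_ (e / (A + 1))) : (fun n => complex.Im (k n)) @ \oo --> (0 : R).
    exact: (ctends_Im quot).
  rewrite divr_gt0 ?ltr_wpDl// => /(_ isT); apply: filterS => n kn.
  have [un0 unA] := uA n; rewrite !normrM normfV (gtr0_norm un0).
  have : `|complex.Re (u n) - x| / complex.Im (u n) <= A by rewrite ler_pdivrMr.
  move: kn; rewrite ler_pdivlMr ?ltr_wpDl//.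
  have := normr_ge0 (complex.Im (k n)).
  by set p := `|_|; set t := _ / _; nra.
have fle := f_function_le_lim ux (fun n => (uA n).1) pl.
have [M fM] : exists M, f_function rho x = M%:E.
  move: (f_function_ge0 rho x) fle; case: (f_function rho x) => // M _ _.
  by exists M.
have [c' c'P] := julia_caratheodory fM mu_rho.
have cc' : c%:C = c' by exact: ctends_unique Flim (c'P _ _ uS).1.
have : d%:C = (1 + M)%:C.
  by apply: ctends_unique quot _; rewrite cc'; exact: (c'P _ _ uS).2.
move=> /complexI ->; rewrite addrC addKr; split=> //.
by rewrite cc'; apply/nontangential_limitP => B v B0 vS; exact: (c'P _ _ vS).1.
Qed.

Lemma f_function_of_JC (x c d : R) : nontangential_limit (F_transform mu) x c%:C ->
  JC_derivative (F_transform mu) x d%:C -> f_function rho x = (d - 1)%:E.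
Proof.
move=> Fc [c' Fc']; rewrite -(nontangential_limit_unique Fc Fc').
move=> /nontangential_limitP /(_ _ _ ltr01 (vertical_stolz x)) quot.
by have [] := f_function_of_sequence (vertical_stolz x) quot.
Qed.

Variables (p : R) (nu : probability borelR R).
Hypothesis p1 : 1 < p.
Hypothesis mu_nu : free_power p mu nu.

(** The subordination function has at a the positive derivative
    [p^-1 + (1 - p^-1) * d]; it carries a vertical sequence at a to a
    nontangential one at x, where [F_transform mu] takes the values of
    [F_transform nu]. *)
Lemma free_power_to_base (a c d : R) :
  nontangential_limit (F_transform nu) a c%:C ->
  JC_derivative (F_transform nu) a d%:C -> 1 <= d ->
  let x := p^-1 * a + (1 - p^-1) * c in
  f_function rho x = (d / (p^-1 + (1 - p^-1) * d) - 1)%:E /\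
  nontangential_limit (F_transform mu) x c%:C.
Proof.
move=> Fc [c' Fc']; rewrite -(nontangential_limit_unique Fc Fc').
move=> /nontangential_limitP /(_ _ _ ltr01 (vertical_stolz a)) quot d1 x.
have p0 : 0 < p := lt_trans ltr01 p1.
have pV0 : 0 < p^-1 by rewrite invr_gt0.
have pV1 : p^-1 < 1 by rewrite invf_lt1.
set D := p^-1 + _.
have D0 : 0 < D by rewrite /D; move: pV0 pV1 d1; nra.
have vS := vertical_stolz a; have [vA va] := vS.
have v0 n : vertical_sequence a n - a%:C != 0.
  by rewrite subr_real_neq0//; exact: (vA n).1.
pose om n := subordination p nu (vertical_sequence a n).
have xE : x%:C = (p^-1)%:C * a%:C + (1 - p^-1)%:C * c%:C :> C.
  by rewrite -!rmorphM -rmorphD.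
have omq : ctends (fun n => (om n - x%:C) / (vertical_sequence a n - a%:C)) D%:C.
  have := ctendsD (ctends_cst (p^-1)%:C) (ctendsZ (1 - p^-1)%:C quot).
  rewrite -rmorphM -rmorphD; apply: eq_ctends => n.
  rewrite /om /subordination xE; move: (v0 n); set V := vertical_sequence a n.
  set G := F_transform nu V; clearbody G; clearbody V => V0; field.
  by rewrite V0 real_complex_neq0 gt_eqF.
have [N omS] := vertical_image_stolz D0 omq.
apply: (f_function_of_sequence omS).
have DC : D%:C != 0 :> C by rewrite real_complex_neq0 gt_eqF.
have := ctends_shift N (ctendsM quot (ctendsV DC omq)).
rewrite -fmorphV -rmorphM; apply: eq_ctends => n.
rewrite quotient_quotient//; congr ((_ - _) / _).
by rewrite /om F_subordination//; exact: (vA _).1.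
Qed.

(** [subordination_inverse] has at x the derivative [1 - (p - 1) * M], which
    is positive exactly because [M < 1 / (p - 1)]. It carries a vertical sequence
    at x to a nontangential one at a. *)
Lemma base_to_free_power (x c M : R) : f_function rho x = M%:E ->
  nontangential_limit (F_transform mu) x c%:C -> M < 1 / (p - 1) ->
  let a := p * x - (p - 1) * c in
  exists2 w, stolz_sequence 1 a w &
    ctends (fun n => (F_transform nu (w n) - c%:C) / (w n - a%:C))
           ((1 + M) / (1 - (p - 1) * M))%:C.
Proof.
move=> fM Fc M1 a; have [c' Fc' quot'] := JC_of_f_function fM Fc.
have quot : ctends (fun n => (F_transform mu (vertical_sequence x n) - c%:C) /
    (vertical_sequence x n - x%:C)) (1 + M)%:C.
  move: quot'; rewrite -(nontangential_limit_unique Fc Fc').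
  by move=> /nontangential_limitP /(_ _ _ ltr01 (vertical_stolz x)).
have [vA va] := vertical_stolz x.
have v0 n : vertical_sequence x n - x%:C != 0.
  by rewrite subr_real_neq0//; exact: (vA n).1.
pose psi n := subordination_inverse mu p (vertical_sequence x n).
have p10 : 0 < p - 1 by rewrite subr_gt0.
have E0 : 0 < 1 - (p - 1) * M.
  by rewrite subr_gt0 mulrC -ltr_pdivlMr.
have aE : a%:C = p%:C * x%:C - (p - 1)%:C * c%:C :> C.
  by rewrite -!rmorphM -rmorphB.
have psiq : ctends (fun n => (psi n - a%:C) / (vertical_sequence x n - x%:C))
    (1 - (p - 1) * M)%:C.
  have := ctendsB (ctends_cst p%:C) (ctendsZ (p - 1)%:C quot).
  have -> : p%:C - (p - 1)%:C * (1 + M)%:C = (1 - (p - 1) * M)%:C.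
    by rewrite -rmorphM -rmorphB; congr (_%:C); ring.
  apply: eq_ctends => n; rewrite /psi /subordination_inverse aE; move: (v0 n); set V := vertical_sequence x n.
  by set G := F_transform mu V; clearbody G; clearbody V => V0; field.
have [N psiS] := vertical_image_stolz E0 psiq.
exists (fun n => psi (n + N)%N) => //.
have EC : (1 - (p - 1) * M)%:C != 0 :> C by rewrite real_complex_neq0 gt_eqF.
have := ctends_shift N (ctendsM quot (ctendsV EC psiq)).
rewrite -fmorphV -rmorphM; apply: eq_ctends => n.
rewrite quotient_quotient//; congr ((_ - _) / _).
rewrite /psi (F_subordination_inverse mu_rho)//; first exact: (vA _).1.
exact: (psiS.1 n).1.
Qed.

(** The real parts in [F_difference] along vertical sequences at x and y. The
    bound of the kernel by the mean of the Poisson masses, themselves at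
    most the values of f, passes to the limit. *)
Lemma two_boundary_points (x y c e M N : R) : x != y ->
  f_function rho x = M%:E -> f_function rho y = N%:E ->
  nontangential_limit (F_transform mu) x c%:C ->
  nontangential_limit (F_transform mu) y e%:C ->
  (c - e) / (x - y) - 1 <= 2^-1 * (M + N).
Proof.
move=> xy fM fN /nontangential_limitP Fx /nontangential_limitP Fy.
have xy0 : x - y != 0 by rewrite subr_eq0.
have [vxA _] := vertical_stolz x; have [vyA _] := vertical_stolz y.
have := ctendsB (Fx _ _ ltr01 (vertical_stolz x)) (Fy _ _ ltr01 (vertical_stolz y)).
move=> /(ctendsZ ((x - y)^-1)%:C); rewrite -rmorphB -rmorphM => /ctends_Re lim.
rewrite lerBlDr mulrC; apply: (cvgr_to_le lim); near=> n.
have [vx0 vy0] := ((vxA n).1, (vyA n).1).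
rewrite (F_difference mu_rho vx0 vy0).
have -> : vertical_sequence x n - vertical_sequence y n = (x - y)%:C.
  by apply: complex_eqP; rewrite !ReImE /= ?subrr.
rewrite mulrA -rmorphM mulVf// rmorph1 mul1r Re_add addrC lerD2r.
apply: le_trans (Re_cintegral_kernel_le rho vx0 vy0) _.
rewrite ler_wpM2l ?invr_ge0// lerD//.
  exact: poisson_mass_le vx0 _ fM.
exact: poisson_mass_le vy0 _ fN.
Unshelve. all: by end_near. Qed.

End FreePower.
End Atoms.

(** * The equivalences, the formulas and the uniqueness of atoms *)

Section Assembly.
Variable R : realType.
Local Notation borelR := (measurableTypeR R).
Variables (mu : probability borelR R) (rho : {finite_measure set borelR -> \bar R}).
Hypothesis mu_npm : ~ is_point_mass mu.
Hypothesis mu_rho : nevanlinna_measure mu rho.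
Variables (p q : R) (nu lam : probability borelR R).
Hypothesis p1 : 1 < p.
Hypothesis q0 : 0 < q.
Hypothesis mu_nu : free_power p mu nu.
Hypothesis nu_lam : boolean_power q nu lam.
Implicit Types (alpha d M : R).

Lemma div_conjugate_exponent alpha r :
  alpha / conjugate_exponent r = alpha * (1 - r^-1).
Proof. by rewrite /conjugate_exponent invrK. Qed.

Lemma conjugate_exponentE : conjugate_exponent p = p / (p - 1).
Proof.
rewrite /conjugate_exponent; have p0 : p != 0 by rewrite gt_eqF// (lt_trans ltr01).
by rewrite -[p^-1]mul1r -{1}(divff p0) -mulrBl invf_div.
Qed.

Lemma div_p_prime alpha : alpha / p_prime p q =
  p^-1 * alpha + (1 - p^-1) * (alpha * (1 - q^-1)).
Proof.
have p0 : 0 < p := lt_trans ltr01 p1.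
rewrite /p_prime invf_div /q_prime.
by field; rewrite !gt_eqF.
Qed.

Lemma base_point_image alpha :
  p * (alpha / p_prime p q) - (p - 1) * (alpha * (1 - q^-1)) = alpha.
Proof.
have p0 : 0 < p := lt_trans ltr01 p1.
by rewrite div_p_prime; field; rewrite !gt_eqF.
Qed.

(** The derivative of [F_transform mu] at the base point, by the chain rule,
    when [F_transform nu] has derivative d. *)
Definition base_derivative d : R := d / (p^-1 + (1 - p^-1) * d).

Lemma base_derivativeE d : 1 <= d -> base_derivative d = p * d / (1 + (p - 1) * d).
Proof.
move=> d1; have p0 : 0 < p := lt_trans ltr01 p1.
have D0 : 0 < 1 + (p - 1) * d.
  by rewrite ltr_pwDl// mulr_ge0// ?subr_ge0 ?(ltW p1)// (le_trans ler01).
rewrite /base_derivative.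
have -> : p^-1 + (1 - p^-1) * d = (1 + (p - 1) * d) / p.
  by field; rewrite gt_eqF.
by rewrite invf_div mulrA [p * d]mulrC.
Qed.

Lemma base_derivative_gt1 d : 1 < d -> 1 < base_derivative d.
Proof.
move=> d1; rewrite base_derivativeE ?ltW// ltr_pdivlMr.
  by move: d1 p1; nra.
by rewrite ltr_pwDl// mulr_ge0// ?subr_ge0 ?(ltW p1)// (le_trans ler01)// ltW.
Qed.

Lemma base_derivative_lt d : 1 <= d -> base_derivative d < p / (p - 1).
Proof.
move=> d1; have p10 : 0 < p - 1 by rewrite subr_gt0.
have D0 : 0 < 1 + (p - 1) * d.
  by rewrite ltr_pwDl// mulr_ge0// ?(ltW p10)// (le_trans ler01).
rewrite base_derivativeE// ltr_pdivrMr// mulrAC ltr_pdivlMr//.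
by have := lt_trans ltr01 p1; nra.
Qed.

Lemma conjugate_exponent_sub1 : p / (p - 1) - 1 = 1 / (p - 1).
Proof. by field; rewrite gt_eqF// subr_gt0. Qed.

Lemma atom_mass_gt0 alpha : is_atom lam alpha -> 0 < fine (lam [set alpha]).
Proof. by rewrite /is_atom atom_mass lte_fin. Qed.

(** An atom of mass 1 gives [F_transform nu] the derivative 1, which makes f
    vanish at the base point, so that [mu] is a point mass. *)
Lemma atom_mass_lt1 alpha : is_atom lam alpha -> fine (lam [set alpha]) < 1.
Proof.
move=> /atom_mass_gt0 m0; have [Fc Fd] := atom_free_power q0 nu_lam m0.
rewrite lt_neqAle; apply/andP; split; last first.
  by rewrite -lee_fin -atom_mass probability_le1.
apply/eqP => m1; apply: mu_npm.
rewrite m1 invr1 subrr mul0r addr0 in Fd.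
have [f0 _] := free_power_to_base mu_rho p1 mu_nu Fc Fd (lexx _).
rewrite mulr1 [p^-1 + (1 - _)]addrC subrK divr1 subrr in f0.
exact: (f_function_zero_point_mass mu_rho f0).
Qed.

Lemma atom_derivative_gt1 alpha : is_atom lam alpha ->
  1 < 1 + ((fine (lam [set alpha]))^-1 - 1) / q.
Proof.
move=> a; have m0 := atom_mass_gt0 a; have m1 := atom_mass_lt1 a.
by rewrite ltrDl divr_gt0// subr_gt0 invf_gt1.
Qed.

Lemma atom_base alpha : is_atom lam alpha ->
  let d := 1 + ((fine (lam [set alpha]))^-1 - 1) / q in
  f_function rho (alpha / p_prime p q) = (base_derivative d - 1)%:E /\
  nontangential_limit (F_transform mu) (alpha / p_prime p q)
    (alpha * (1 - q^-1))%:C.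
Proof.
move=> a d; have [Fc Fd] := atom_free_power q0 nu_lam (atom_mass_gt0 a).
rewrite div_p_prime; apply: (free_power_to_base mu_rho p1 mu_nu Fc Fd).
by rewrite ltW// atom_derivative_gt1.
Qed.

Lemma base_atom alpha M : f_function rho (alpha / p_prime p q) = M%:E ->
  nontangential_limit (F_transform mu) (alpha / p_prime p q)
    (alpha * (1 - q^-1))%:C ->
  0 < M < 1 / (p - 1) -> is_atom lam alpha.
Proof.
move=> fM Fc /andP[M0 M1].
have [w] := base_to_free_power mu_rho p1 mu_nu fM Fc M1.
rewrite base_point_image => wS quot.
have E0 : 0 < 1 - (p - 1) * M.
  by rewrite subr_gt0 mulrC -ltr_pdivlMr ?subr_gt0.
have L0 : 0 < 1 + q * ((1 + M) / (1 - (p - 1) * M) - 1).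
  have -> : (1 + M) / (1 - (p - 1) * M) - 1 = p * M / (1 - (p - 1) * M).
    by field; rewrite gt_eqF.
  have p0 : 0 < p := lt_trans ltr01 p1.
  by rewrite addr_gt0// mulr_gt0// divr_gt0// mulr_gt0.
rewrite /is_atom atom_mass lte_fin (atom_of_free_power q0 nu_lam wS quot L0).
by rewrite invr_gt0.
Qed.

Lemma atom_equivalences_holds alpha : atom_equivalences p q mu rho nu lam alpha.
Proof.
rewrite /atom_equivalences div_conjugate_exponent.
tfae.
- move=> a; have [Fc Fd] := atom_free_power q0 nu_lam (atom_mass_gt0 a).
  split; first exact: Fc.
  by exists (1 + ((fine (lam [set alpha]))^-1 - 1) / q); first exact: atom_derivative_gt1.
- move=> [Fc [d d1 Fd]].
  have := free_power_to_base mu_rho p1 mu_nu Fc Fd (ltW d1).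
  rewrite /= -div_p_prime => -[fM Fmu]; split; first exact: Fmu.
  exists (base_derivative d).
    by rewrite base_derivative_gt1// conjugate_exponentE base_derivative_lt// ltW.
  by have := JC_of_f_function mu_rho fM Fmu; rewrite addrC subrK.
- move=> [Fmu [d /andP[d1]]]; rewrite conjugate_exponentE => d2 Fd.
  split; first exact: Fmu.
  rewrite (f_function_of_JC mu_rho Fmu Fd) !lte_fin subr_gt0 d1 /=.
  by rewrite -conjugate_exponent_sub1 ltrD2r.
move=> [Fmu /andP[f0 f1]].
have [M fM] : exists M, f_function rho (alpha / p_prime p q) = M%:E.
  by move: f0 f1; case: (f_function _ _) => // M _ _; exists M.
by rewrite fM !lte_fin in f0 f1; apply: base_atom fM Fmu _; rewrite f0.
Qed.

Lemma atom_formulas_holds alpha : q_prime p q != 0 ->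
  atom_formulas p q mu rho nu lam alpha.
Proof.
move=> q'0 x r r1 mr.
have r0 : 0 < r := lt_trans ltr01 r1.
have r10 : 0 < r - 1 by rewrite subr_gt0.
have p0 : 0 < p := lt_trans ltr01 p1.
have mE : fine (lam [set alpha]) = 1 - r^-1 by rewrite mr.
have a : is_atom lam alpha by rewrite /is_atom mr lte_fin subr_gt0 invf_lt1.
have dE : 1 + ((1 - r^-1)^-1 - 1) / q = 1 + 1 / (q * (r - 1)).
  have -> : 1 - r^-1 = (r - 1) / r by field; rewrite gt_eqF.
  by rewrite invf_div; field; rewrite !gt_eqF.
have d1 := atom_derivative_gt1 a.
have [_ Fd] := atom_free_power q0 nu_lam (atom_mass_gt0 a).
have [fM Fmu] := atom_base a.
rewrite mE dE in d1 Fd fM; split; first exact: Fd.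
have den0 : 0 < p * q * (r - 1) + p - 1.
  by rewrite -addrA addr_gt0 ?subr_gt0// !mulr_gt0.
have bE : base_derivative (1 + 1 / (q * (r - 1))) =
    (p * q * (r - 1) + p) / (p * q * (r - 1) + p - 1).
  rewrite base_derivativeE ?ltW//.
  have qr0 : 0 < q * (r - 1) by rewrite mulr_gt0.
  have -> : 1 + 1 / (q * (r - 1)) = (q * (r - 1) + 1) / (q * (r - 1)).
    by field; rewrite !gt_eqF.
  field.
  by rewrite !gt_eqF//=; apply/eqP => h; move: den0; nra.
exists (base_derivative (1 + 1 / (q * (r - 1)))); split.
- by have := JC_of_f_function mu_rho fM Fmu; rewrite addrC subrK.
- by rewrite fM -EFinD [1 + (_ - _)]addrC subrK.
- exact: bE.
have -> : q_prime p q * (r * p_prime p q - 1) = p * q * (r - 1) + p - 1.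
  rewrite mulrBr mulr1 mulrCA /p_prime [q_prime p q * _]mulrC divfK//.
  by rewrite /q_prime; ring.
by rewrite bE; field; rewrite gt_eqF.
Qed.

(** The hypothesis says that [q_prime p q] is negative. At the base points of two
    atoms the slope of [F_transform mu] minus 1 is [- (q_prime p q)^-1], which
    exceeds [1 / (p - 1)], whereas [two_boundary_points] bounds it by the mean of
    two values of f below [1 / (p - 1)]. *)
Lemma at_most_one_atom_holds : conjugate_exponent p * q < 1 -> at_most_one_atom lam.
Proof.
rewrite conjugate_exponentE mulrAC ltr_pdivrMr ?subr_gt0// mul1r => pq a b aA bA.
have p0 : 0 < p := lt_trans ltr01 p1.
apply: contrapT => /eqP ab; have ab0 : a - b != 0 by rewrite subr_eq0.
have q'0 : q_prime p q < 0 by rewrite /q_prime; move: pq; lra.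
have [fa Fa] := atom_base aA; have [fb Fb] := atom_base bA.
have := base_derivative_lt (ltW (atom_derivative_gt1 aA)).
have := base_derivative_lt (ltW (atom_derivative_gt1 bA)).
move: (base_derivative _) (base_derivative _) fa fb => da db fa fb dblt dalt.
have xE t : t / p_prime p q = t * (q_prime p q / (p * q)).
  by rewrite /p_prime invf_div.
have k0 : q_prime p q / (p * q) != 0.
  by rewrite mulf_neq0 ?invr_eq0 ?(lt_eqF q'0)// gt_eqF// mulr_gt0.
have xy : a / p_prime p q != b / p_prime p q.
  by rewrite !xE -subr_eq0 -mulrBl mulf_neq0.
have := two_boundary_points mu_rho xy fa fb Fa Fb.
set s := q_prime p q in q'0 *.
have -> : (a * (1 - q^-1) - b * (1 - q^-1)) / (a / p_prime p q - b / p_prime p q) - 1 =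
    (p * (q - 1) - s) / s.
  by rewrite !xE -/s; field; rewrite -mulrBl mulf_neq0 ?(lt_eqF q'0)// !gt_eqF.
have -> : p * (q - 1) - s = -1 by rewrite /s /q_prime; ring.
have : (p - 1)^-1 < (- s)^-1.
  have p10 : 0 < p - 1 by rewrite subr_gt0.
  have pq0 : 0 < p * q by rewrite mulr_gt0.
  rewrite ltf_pV2 ?posrE ?oppr_gt0// /s /q_prime.
  by move: pq0; lra.
rewrite mulN1r invrN; move: dblt dalt conjugate_exponent_sub1; rewrite div1r; lra.
Qed.

End Assembly.

Theorem proposition5p6 (R : realType)
    (mu : probability (measurableTypeR R) R)
    (rho : {finite_measure set (measurableTypeR R) -> \bar R})
    (mu_not_point_mass : ~ is_point_mass mu)
    (mu_rho : nevanlinna_measure mu rho) :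
  (forall (p q : R) (nu lam : probability (measurableTypeR R) R),
     1 < p -> 0 < q -> is_Bpq p q mu nu lam ->
     (conjugate_exponent p * q <> 1 ->
        forall alpha : R,
          atom_equivalences p q mu rho nu lam alpha /\
          atom_formulas p q mu rho nu lam alpha) /\
     (conjugate_exponent p * q < 1 -> at_most_one_atom lam)) /\
  (forall (t : R) (nu lam : probability (measurableTypeR R) R),
     0 < t -> t <> 1 -> is_Bt t mu nu lam ->
     let p := t + 1 in
     let q := 1 / (t + 1) in
     (forall alpha : R,
        atom_equivalences p q mu rho nu lam alpha /\
        atom_formulas p q mu rho nu lam alpha) /\
     (conjugate_exponent p * q < 1 -> at_most_one_atom lam)).
Proof.
have general (p q : R) (nu lam : probability (measurableTypeR R) R) :
    1 < p -> 0 < q -> is_Bpq p q mu nu lam ->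
    (conjugate_exponent p * q <> 1 -> forall alpha : R,
       atom_equivalences p q mu rho nu lam alpha /\
       atom_formulas p q mu rho nu lam alpha) /\
    (conjugate_exponent p * q < 1 -> at_most_one_atom lam).
  move=> p1 q0 [mu_nu nu_lam]; split=> [pq alpha|].
    split.
      exact: (atom_equivalences_holds mu_not_point_mass mu_rho p1 q0 mu_nu nu_lam).
    apply: (atom_formulas_holds mu_not_point_mass mu_rho p1 q0 mu_nu nu_lam).
    apply/eqP => q'0; apply: pq; rewrite conjugate_exponentE// mulrAC.
    have p10 : p - 1 != 0 by rewrite gt_eqF// subr_gt0.
    by apply: (canLR (mulfK p10)); move: q'0; rewrite /q_prime; lra.
  exact: (at_most_one_atom_holds mu_not_point_mass mu_rho p1 q0 mu_nu nu_lam).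
split; first exact: general.
move=> t nu lam t0 t1 Bt p q.
have p1 : 1 < p by rewrite ltrDr.
have q0 : 0 < q by rewrite divr_gt0// addr_gt0.
have [eqs atmost] := general p q nu lam p1 q0 Bt.
split; last exact: atmost.
apply: eqs => pq; apply: t1; move: pq.
rewrite conjugate_exponentE// /p /q addrK mul1r mulrAC divff ?gt_eqF ?addr_gt0// mul1r.
by move=> /(congr1 GRing.inv); rewrite invrK invr1.
Qed.
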